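(* Fix a prime $p$, an integer $k\geq 1$, and a $k$-surjective flag $\mathbf{G}=(G_k\twoheadrightarrow \dots\twoheadrightarrow G_1)$ of finitely generated $\mathbb{Z}_p$-modules with $|G_k|<\infty$. Let $n\geq r(G_k)$ and let $M_1,\dots,M_k\in \mathrm{Mat}_n(\mathbb{Z}_p)$ be independent Haar-random matrices. Then \[ \mathbb{P}\big(\mathbf{cok}(M_1,\dots,M_k)\simeq \mathbf{G}\big) = \frac{1}{|\mathrm{Aut}(\mathbf{G})|} \Big(\prod_{i=n-r(G_k)+1}^n (1-p^{-i})\Big) \Big(\prod_{i=1}^n (1-p^{-i})\Big)^k. \] In particular, \[ \lim_{n\to \infty}\mathbb{P}\big(\mathbf{cok}(M_1,\dots,M_k)\simeq \mathbf{G}\big) = \frac{1}{|\mathrm{Aut}(\mathbf{G})|} \Big(\prod_{i=1}^\infty (1-p^{-i})\Big)^k. \]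
   Context: A $k$-surjective flag of finitely generated $\mathbb{Z}_p$-modules is a diagram of surjective $\mathbb{Z}_p$-linear maps $G_k\overset{\phi_{k-1}}{\twoheadrightarrow}\dots\overset{\phi_1}{\twoheadrightarrow} G_1$ (with $G_0:=0$). An isomorphism of two such flags $(G_i,\phi_i)\to(G_i',\phi_i')$ is a tuple of isomorphisms $\sigma_i:G_i\to G_i'$ with $\phi_i'\circ\sigma_{i+1}=\sigma_i\circ\phi_i$ for all $i$; $\mathrm{Aut}(\mathbf{G})$ is the group of automorphisms of $\mathbf{G}$ in this sense. For a finitely generated $\mathbb{Z}_p$-module $G$, $r(G):=\dim_{\mathbb{F}_p} G/pG$. For $M_1,\dots,M_k\in\mathrm{Mat}_n(\mathbb{Z}_p)$, $\mathbf{cok}(M_1,\dots,M_k)$ is the flag $\mathrm{cok}(M_1\cdots M_k)\twoheadrightarrow\dots\twoheadrightarrow\mathrm{cok}(M_1)$, where $\mathrm{cok}(M_1\cdots M_i)=\mathbb{Z}_p^n/\mathrm{im}(M_1\cdots M_i)$ and the map $\mathrm{cok}(M_1\cdots M_{i+1})\twoheadrightarrow\mathrm{cok}(M_1\cdots M_i)$ is induced by the inclusion $\mathrm{im}(M_1\cdots M_{i+1})\subseteq\mathrm{im}(M_1\cdots M_i)$. Haar-random means distributed according to the unique Haar probability measure on the compact group $\mathrm{Mat}_n(\mathbb{Z}_p)\cong\mathbb{Z}_p^{n^2}$. *)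

(* Defs.v *)
From HB Require Import structures.
From mathcomp Require Import all_boot all_order all_algebra.
From mathcomp Require Import all_classical all_reals all_analysis.

Set Implicit Arguments.
Unset Strict Implicit.
Unset Printing Implicit Defensive.

Import Order.TTheory GRing.Theory Num.Theory.
Import numFieldNormedType.Exports.

Local Open Scope classical_set_scope.
Local Open Scope ring_scope.

(* The ring of p-adic integers, as the inverse limit of the rings Z/p^m: the
   m-th component of an element is its residue in {0, ..., p^m - 1}, and
   compatibility with the projections forces it to be reduced. The primality
   proof is a (proof-irrelevant) parameter so that the ring is nontrivial. *)
Record padic (p : nat) (p_pr : prime p) := Padic {
  residue :> nat -> int;
  _ : `[< forall m, residue m = (residue m.+1 %% (p ^ m)%N%:Z)%Z >]
}.

Section PadicRing.
Variables (p : nat) (p_pr : prime p).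
Local Notation Zp := (padic p_pr).
Local Notation pw m := ((p ^ m)%N%:Z).

HB.instance Definition _ := [isSub for @residue p p_pr].
HB.instance Definition _ := [Choice of Zp by <:].

Lemma residueS (x : Zp) m : x m = (x m.+1 %% pw m)%Z.
Proof. by case: x => x /= /asboolP. Qed.

Lemma residue_mod (x : Zp) m : (x m %% pw m)%Z = x m.
Proof. by rewrite residueS modz_mod. Qed.

Lemma padicP (x y : Zp) : (forall m, x m = y m) -> x = y.
Proof. by move=> xy; apply/val_inj/funext. Qed.

Lemma modzMpow (a : int) m : ((a %% pw m.+1)%Z %% pw m)%Z = (a %% pw m)%Z.
Proof.
have aE : a = (a %/ pw m.+1)%Z * p * pw m + (a %% pw m.+1)%Z.
  by rewrite -mulrA -PoszM -expnS -divz_eq.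
by rewrite [in RHS]aE modzMDl.
Qed.

Lemma padic_of_subproof (f : nat -> int) :
    (forall m, (f m.+1 = f m %[mod pw m])%Z) ->
  `[< forall m, (f m %% pw m)%Z = ((f m.+1 %% pw m.+1)%Z %% pw m)%Z >].
Proof. by move=> fP; apply/asboolP => m; rewrite modzMpow fP. Qed.

Definition padic_of f (fP : forall m, (f m.+1 = f m %[mod pw m])%Z) : Zp :=
  @Padic p p_pr (fun m => f m %% pw m)%Z (padic_of_subproof fP).

Lemma padic_cstP (a : int) m : (a = a %[mod pw m])%Z.
Proof. by []. Qed.

Lemma padic_oppP (x : Zp) m : (- x m.+1 = - x m %[mod pw m])%Z.
Proof. by rewrite [x m]residueS modzNm. Qed.

Lemma padic_addP (x y : Zp) m :
  (x m.+1 + y m.+1 = x m + y m %[mod pw m])%Z.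
Proof. by rewrite [x m]residueS [y m]residueS modzDm. Qed.

Lemma padic_mulP (x y : Zp) m :
  (x m.+1 * y m.+1 = x m * y m %[mod pw m])%Z.
Proof. by rewrite [x m]residueS [y m]residueS modzMm. Qed.

Definition padic_zero : Zp := padic_of (padic_cstP 0).
Definition padic_one : Zp := padic_of (padic_cstP 1).
Definition padic_opp (x : Zp) : Zp := padic_of (padic_oppP x).
Definition padic_add (x y : Zp) : Zp := padic_of (padic_addP x y).
Definition padic_mul (x y : Zp) : Zp := padic_of (padic_mulP x y).

Lemma padic_addA : associative padic_add.
Proof. by move=> x y z; apply: padicP => m /=; rewrite modzDmr modzDml addrA. Qed.

Lemma padic_addC : commutative padic_add.
Proof. by move=> x y; apply: padicP => m /=; rewrite addrC. Qed.

Lemma padic_add0 : left_id padic_zero padic_add.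
Proof. by move=> x; apply: padicP => m /=; rewrite modzDml add0r residue_mod. Qed.

Lemma padic_addN : left_inverse padic_zero padic_opp padic_add.
Proof. by move=> x; apply: padicP => m /=; rewrite modzDml addNr. Qed.

HB.instance Definition _ := GRing.isZmodule.Build Zp
  padic_addA padic_addC padic_add0 padic_addN.

Lemma padic_mulA : associative padic_mul.
Proof. by move=> x y z; apply: padicP => m /=; rewrite modzMmr modzMml mulrA. Qed.

Lemma padic_mulC : commutative padic_mul.
Proof. by move=> x y; apply: padicP => m /=; rewrite mulrC. Qed.

Lemma padic_mul1 : left_id padic_one padic_mul.
Proof. by move=> x; apply: padicP => m /=; rewrite modzMml mul1r residue_mod. Qed.

Lemma padic_mulD : left_distributive padic_mul padic_add.
Proof.
by move=> x y z; apply: padicP => m /=; rewrite modzMml modzDm mulrDl.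
Qed.

Lemma padic_one_neq0 : padic_one != 0.
Proof.
apply/eqP => /(congr1 (fun x : Zp => x 1%N)) /=.
by rewrite mod0z modz_small //= ltz_nat expn1 prime_gt1.
Qed.

HB.instance Definition _ := GRing.Zmodule_isComNzRing.Build Zp
  padic_mulA padic_mulC padic_mul1 padic_mulD padic_one_neq0.

(* The p-adic topology: the residue classes x + p^m Zp form a basis of
   neighbourhoods of x. *)
Definition padic_open : set (set Zp) :=
  [set A : set Zp | forall x : Zp, A x ->
    exists m, forall y : Zp, y m = x m -> A y].

Lemma residue_le (x y : Zp) m l : (m <= l)%N -> x l = y l -> x m = y m.
Proof.
elim: l => [|l IHl]; first by rewrite leqn0 => /eqP ->.
rewrite leq_eqVlt ltnS => /predU1P[->//|/IHl ml xy]; apply: ml.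
by rewrite (residueS x) (residueS y) xy.
Qed.

Lemma padic_openT : padic_open setT.
Proof. by move=> x _; exists 0%N. Qed.

Lemma padic_openI : setI_closed padic_open.
Proof.
move=> A B Ao Bo x [/Ao[m Am] /Bo[l Bl]]; exists (maxn m l) => y xy.
split; [apply: Am|apply: Bl]; apply: residue_le xy.
  exact: leq_maxl.
exact: leq_maxr.
Qed.

Lemma padic_open_bigU (I : Type) (f : I -> set Zp) :
  (forall i, padic_open (f i)) -> padic_open (\bigcup_i f i).
Proof. by move=> fo x [i _ /fo[m fm]]; exists m => y /fm; exists i. Qed.

HB.instance Definition _ := isOpenTopological.Build Zp
  padic_openT padic_openI padic_open_bigU.
HB.instance Definition _ := isPointed.Build Zp 0.

End PadicRing.

Section QuotientModule.
Local Open Scope quotient_scope.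
Variables (R : pzRingType) (V : lmodType R).
Variables (S : {pred V}) (S_sub : submod_closed S).

Definition submod_pred (_ : submod_closed S) : {pred V} := S.

HB.instance Definition _ :=
  GRing.isZmodClosed.Build V (submod_pred S_sub) (GRing.submod_closedB S_sub).

Definition quotmod := Quotient.quot (submod_pred S_sub).

HB.instance Definition _ := GRing.Zmodule.on quotmod.

Definition quotmod_pi (v : V) : quotmod :=
  \pi_(Quotient.quot (submod_pred S_sub)) v.
Definition quotmod_repr (x : quotmod) : V :=
  repr (x : Quotient.quot (submod_pred S_sub)).

Lemma quotmod_reprK : cancel quotmod_repr quotmod_pi.
Proof. exact: reprK. Qed.

Lemma quotmod_piP (u v : V) : quotmod_pi u = quotmod_pi v <-> u - v \in S.
Proof.
split=> [/eqP|uv]; first by rewrite -(Quotient.idealrBE (submod_pred S_sub)).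
by apply/eqP; rewrite -(Quotient.idealrBE (submod_pred S_sub)).
Qed.

Lemma quotmod_piD : {morph quotmod_pi : u v / u + v}.
Proof. by move=> u v; rewrite /quotmod_pi piE. Qed.

Lemma quotmod_reprB (v : V) : v - quotmod_repr (quotmod_pi v) \in S.
Proof. by apply/quotmod_piP; rewrite quotmod_reprK. Qed.

Definition quotmod_scale (a : R) (x : quotmod) : quotmod :=
  quotmod_pi (a *: quotmod_repr x).

Lemma quotmod_piZ (a : R) (v : V) :
  quotmod_pi (a *: v) = quotmod_scale a (quotmod_pi v).
Proof.
apply/quotmod_piP; rewrite -scalerBr.
have [S0 Slin] := S_sub; rewrite -[_ *: _]addr0; apply: Slin => //.
exact: quotmod_reprB.
Qed.

Lemma quotmod_scaleA a b x :
  quotmod_scale a (quotmod_scale b x) = quotmod_scale (a * b) x.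
Proof. by rewrite -[x]quotmod_reprK -!quotmod_piZ scalerA. Qed.

Lemma quotmod_scale1 : left_id 1 quotmod_scale.
Proof. by move=> x; rewrite -[x]quotmod_reprK -!quotmod_piZ scale1r. Qed.

Lemma quotmod_scaleDr : right_distributive quotmod_scale +%R.
Proof.
move=> a x y; rewrite -[x]quotmod_reprK -[y]quotmod_reprK.
by rewrite -quotmod_piD -!quotmod_piZ scalerDr quotmod_piD.
Qed.

Lemma quotmod_scaleDl x : {morph quotmod_scale^~ x : a b / a + b}.
Proof.
move=> a b; rewrite -[x]quotmod_reprK.
by rewrite -!quotmod_piZ scalerDl quotmod_piD.
Qed.

HB.instance Definition _ := GRing.Zmodule_isLmodule.Build R quotmod
  quotmod_scaleA quotmod_scale1 quotmod_scaleDr quotmod_scaleDl.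

Lemma quotmod_pi_is_linear : linear quotmod_pi.
Proof. by move=> a u v; rewrite quotmod_piD quotmod_piZ. Qed.

HB.instance Definition _ :=
  GRing.isLinear.Build R V quotmod *:%R quotmod_pi quotmod_pi_is_linear.

End QuotientModule.

(* For submodules S <= T of V, the linear map V / S -> V / T induced by the
   identity of V. *)
Section QuotientMap.
Variables (R : pzRingType) (V : lmodType R) (S T : {pred V}).
Variables (S_sub : submod_closed S) (T_sub : submod_closed T).
Hypothesis ST : {subset S <= T}.

Definition quotmod_map (_ : {subset S <= T}) (x : quotmod S_sub) :
  quotmod T_sub := quotmod_pi T_sub (quotmod_repr x).

Lemma quotmod_map_pi v :
  quotmod_map ST (quotmod_pi S_sub v) = quotmod_pi T_sub v.
Proof.
by apply/esym/quotmod_piP; apply: ST; apply: quotmod_reprB.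
Qed.

Lemma quotmod_map_is_linear : linear (quotmod_map ST).
Proof.
move=> a x y; rewrite -[x]quotmod_reprK -[y]quotmod_reprK.
by rewrite -quotmod_pi_is_linear !quotmod_map_pi quotmod_pi_is_linear.
Qed.

HB.instance Definition _ := GRing.isLinear.Build R (quotmod S_sub)
  (quotmod T_sub) *:%R (quotmod_map ST) quotmod_map_is_linear.

Lemma quotmod_map_surj y : exists x, quotmod_map ST x = y.
Proof.
exists (quotmod_pi S_sub (quotmod_repr y)).
by rewrite quotmod_map_pi quotmod_reprK.
Qed.

End QuotientMap.

Definition finitely_generated (R : pzRingType) (V : lmodType R) : Prop :=
  exists (m : nat) (g : 'I_m -> V),
    forall x : V, exists c : 'I_m -> R, x = \sum_(i < m) c i *: g i.

(* The dimension of a finite-dimensional vector space (0 by convention if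
   there is no finite basis). *)
Definition vdim (F : fieldType) (V : lmodType F) : nat :=
  xget 0%N [set r | exists e : 'I_r -> V,
    bijective (fun c : 'rV[F]_r => \sum_(i < r) c 0 i *: e i)].

(* The number of elements of a finite set (0 by convention for an infinite
   set). *)
Definition ncard (T : Type) (A : set T) : nat :=
  xget 0%N [set m | (A #= `I_m)%card].

Section Rank.
Variables (p : nat) (p_pr : prime p) (G : lmodType (padic p_pr)).

Definition pmul_pred : {pred G} := fun x => `[< exists y : G, x = p%:R *: y >].

Lemma pmul_submod : submod_closed pmul_pred.
Proof.
split; first by apply/asboolP; exists 0; rewrite scaler0.
move=> a _ _ /asboolP[u ->] /asboolP[v ->]; apply/asboolP; exists (a *: u + v).
by rewrite scalerDr !scalerA mulrC.
Qed.

(* G / pG, a type of its own so that it can carry its F_p-structure. *)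
Definition quotp : Type := quotmod pmul_submod.

HB.instance Definition _ := GRing.Zmodule.on quotp.

(* A residue class in F_p acts through any of its integer representatives. *)
Definition quotp_scale (a : 'F_p) (x : quotp) : quotp := x *+ a.

Lemma quotp_char (x : quotp) : x *+ p = 0.
Proof.
rewrite -[x](@quotmod_reprK _ _ _ pmul_submod) -raddfMn -scaler_nat.
rewrite -[RHS](raddf0 (quotmod_pi pmul_submod)); apply/quotmod_piP.
by rewrite subr0; apply/asboolP; exists (quotmod_repr x).
Qed.

Lemma quotp_modn (x : quotp) m : x *+ (m %% p) = x *+ m.
Proof.
by rewrite {2}(divn_eq m p) mulrnDr mulnC mulrnA quotp_char mul0rn add0r.
Qed.

Lemma quotp_scaleA a b x : quotp_scale a (quotp_scale b x) = quotp_scale (a * b) x.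
Proof.
rewrite /quotp_scale /= -mulrnA -(quotp_modn x (b * a)%N) mulnC.
by congr (x *+ (_ %% _)); rewrite Fp_cast.
Qed.

Lemma quotp_scale1 : left_id 1 quotp_scale.
Proof. by move=> x; rewrite /quotp_scale /= mulr1n. Qed.

Lemma quotp_scaleDr : right_distributive quotp_scale +%R.
Proof. by move=> a x y; rewrite /quotp_scale mulrnDl. Qed.

Lemma quotp_scaleDl x : {morph quotp_scale^~ x : a b / a + b}.
Proof.
move=> a b; rewrite /quotp_scale /= -mulrnDr -(quotp_modn x (a + b)%N).
by congr (x *+ (_ %% _)); rewrite Fp_cast.
Qed.

HB.instance Definition _ := GRing.Zmodule_isLmodule.Build 'F_p quotp
  quotp_scaleA quotp_scale1 quotp_scaleDr quotp_scaleDl.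

(* r(G) = dim_(F_p) G / pG *)
Definition prank : nat := vdim quotp.

End Rank.

Section Flags.
Variables (p : nat) (p_pr : prime p).
Local Notation Zp := (padic p_pr).

(* A k-surjective flag G_k ->> ... ->> G_1; the ordinal i : 'I_k stands for the
   index i + 1. The arrow G_(j+1) ->> G_(i+1) is indexed by both its ends and an
   equation j = i + 1, which avoids casts between ordinals. *)
Record flag (k : nat) := Flag {
  flag_obj :> 'I_k -> lmodType Zp;
  flag_map : forall i j : 'I_k, j = i.+1 :> nat ->
    {linear flag_obj j -> flag_obj i};
  flag_fg : forall i, finitely_generated (flag_obj i);
  flag_surj : forall (i j : 'I_k) (ij : j = i.+1 :> nat) (y : flag_obj i),
    exists x : flag_obj j, flag_map ij x = y
}.

Definition flag_iso (k : nat) (F F' : flag k) : set (forall i, F i -> F' i) :=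
  [set s | (forall i, linear (s i)) /\ (forall i, bijective (s i)) /\
    forall (i j : 'I_k) (ij : j = i.+1 :> nat) (x : F j),
      flag_map F' ij (s j x) = s i (flag_map F ij x)].
Arguments flag_iso {k} F F' _.

Definition flag_isomorphic (k : nat) (F F' : flag k) : Prop :=
  exists s, flag_iso F F' s.

Definition flag_Aut (k : nat) (F : flag k) : set (forall i, F i -> F i) :=
  flag_iso F F.

End Flags.

Arguments flag_iso {p p_pr k} F F' _.
Arguments flag_Aut {p p_pr k} F _.

Section Cokernel.
Variables (p : nat) (p_pr : prime p) (n : nat).
Local Notation Zp := (padic p_pr).

Definition im_pred (A : 'M[Zp]_n) : {pred 'cV[Zp]_n} :=
  fun v => `[< exists w : 'cV[Zp]_n, v = A *m w >].

Lemma im_submod (A : 'M[Zp]_n) : submod_closed (im_pred A).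
Proof.
split; first by apply/asboolP; exists 0; rewrite mulmx0.
move=> a _ _ /asboolP[u ->] /asboolP[v ->]; apply/asboolP; exists (a *: u + v).
by rewrite mulmxDr scalemxAr.
Qed.

Definition cok (A : 'M[Zp]_n) : lmodType Zp := quotmod (im_submod A).

Lemma cok_fg (A : 'M[Zp]_n) : finitely_generated (cok A).
Proof.
exists n, (fun i => quotmod_pi (im_submod A) (delta_mx i 0)) => x.
exists (fun i => quotmod_repr x i 0).
rewrite -[LHS]quotmod_reprK {1}[quotmod_repr x]matrix_sum_delta raddf_sum.
by apply: eq_bigr => i _; rewrite big_ord1 /= quotmod_piZ.
Qed.

(* The ordered product M_1 M_2 ... M_(i+1), where M_(j+1) is written M j. *)
Definition mx_prefix (k : nat) (M : 'I_k -> 'M[Zp]_n) (i : 'I_k) : 'M[Zp]_n :=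
  \prod_(j < k | (j <= i)%N) M j.

Lemma mx_prefixS (k : nat) (M : 'I_k -> 'M[Zp]_n) (i j : 'I_k) :
  j = i.+1 :> nat -> mx_prefix M j = mx_prefix M i *m M j.
Proof.
move=> ij; pose M' m : 'M[Zp]_n := if insub m is Some o then M o else 1%:M.
have prefE (l : 'I_k) : mx_prefix M l = \prod_(0 <= m < l.+1) M' m.
  rewrite (big_nat_widen _ _ k) //= big_mkord.
  by apply: eq_big => [m|m _]; rewrite ?ltnS // /M' valK.
by rewrite !prefE big_nat_recr //= ij -{2}ij /M' valK.
Qed.

Lemma im_prefixS (k : nat) (M : 'I_k -> 'M[Zp]_n) (i j : 'I_k) :
  j = i.+1 :> nat ->
  {subset im_pred (mx_prefix M j) <= im_pred (mx_prefix M i)}.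
Proof.
move=> ij _ /asboolP[w ->]; apply/asboolP; exists (M j *m w).
by rewrite (mx_prefixS _ ij) mulmxA.
Qed.

Definition cok_flag (k : nat) (M : 'I_k -> 'M[Zp]_n) : flag p_pr k :=
  @Flag p p_pr k (fun i => cok (mx_prefix M i))
    (fun i j ij => @quotmod_map _ _ _ _ (im_submod (mx_prefix M j))
                     (im_submod (mx_prefix M i)) (im_prefixS ij))
    (fun i => cok_fg (mx_prefix M i))
    (fun i j ij => @quotmod_map_surj _ _ _ _ (im_submod (mx_prefix M j))
                     (im_submod (mx_prefix M i)) (im_prefixS ij)).

End Cokernel.

(* Mat_n(Zp) with its Borel sigma-algebra, for the entrywise p-adic topology. *)
Definition borel_mx (p : nat) (p_pr : prime p) (n : nat) :=
  g_sigma_algebraType (@open 'M[padic p_pr]_n).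

(* Translation invariance of a Borel measure on Mat_n(Zp); together with total
   mass 1, this characterizes the Haar probability measure. *)
Definition translation_invariant (R : realType) (p : nat) (p_pr : prime p)
    (n : nat) (mu : set (borel_mx p_pr n) -> \bar R) : Prop :=
  forall (B : 'M[padic p_pr]_n) (A : set (borel_mx p_pr n)), measurable A ->
    mu [set (X : 'M[padic p_pr]_n) + B | X in A] = mu A.

Definition haar_random (R : realType) (d : measure_display)
    (T : measurableType d) (P : probability T R) (p : nat) (p_pr : prime p)
    (n : nat) (X : {RV P >-> borel_mx p_pr n}) : Prop :=
  translation_invariant (distribution P X).

Definition mutually_independent (R : realType) (d d' : measure_display)
    (T : measurableType d) (E : measurableType d') (P : probability T R)
    (I : finType) (X : I -> {RV P >-> E}) : Prop :=
  forall (J : {set I}) (A : I -> set E), (forall i, measurable (A i)) ->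
    P (\bigcap_(i in [set` J]) (X i @^-1` A i)) =
    (\prod_(i in J) P (X i @^-1` A i))%E.

Definition cok_event (R : realType) (d : measure_display)
    (T : measurableType d) (P : probability T R) (p : nat) (p_pr : prime p)
    (n k : nat) (M : 'I_k -> {RV P >-> borel_mx p_pr n}) (G : flag p_pr k) :
    set T :=
  [set t | flag_isomorphic (cok_flag (fun i => M i t : 'M[padic p_pr]_n)) G].

(* Main.v *)
Require Import Defs.
From HB Require Import structures.
From mathcomp Require Import all_boot all_order all_algebra.
From mathcomp Require Import all_fingroup all_solvable.
From mathcomp Require Import zify ring.

(* A marking is a surjection Zp^n -> G_k carrying the flag of the images of the
   products M_1 ... M_i to the kernels of Zp^n -> G_k -> G_i; given
   (M_1, ..., M_k), it exists iff the cokernel flag is isomorphic to G, and then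
   markings form a torsor under Aut(G). By Nakayama, if p^e kills G_k, being
   marked depends only on the M_i modulo p^(e+1), which are independent and
   uniform. So one counts marked tuples over Z/p^(e+1) in two ways. A finite
   abelian p-group H with p^r = |H/pH| has |H|^n prod_(n-r < i <= n) (1 - p^-i)
   generating n-tuples. This counts the surjections onto G_k; and, for a fixed
   surjection, it also counts the choices of M_i given the earlier ones: its
   columns must map to generators of a submodule N containing p^e (Z/p^(e+1))^n,
   and |N/pN| = |N[p]| = p^n for any such N. *)

Set Implicit Arguments.
Unset Strict Implicit.
Unset Printing Implicit Defensive.

Import Order.TTheory GRing.Theory Num.Theory FinRing.Theory.

(** The modulus is [p^(e+1)] rather than [p^e] for two reasons. The submodules to be counted contain
    [p^e V], where [V = (Z/p^(e+1))^n]; this is the whole [p]-torsion of [V], so they all have the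
    same rank [n]. And the error terms, in [p^(e+1) Zp^n], are [p] times elements of [p^e Zp^n], as
    Nakayama requires. With the rank fixed, the number of choices of [M_i] depends on the chain of
    kernels [K_i] only through [|K_i|^n / |K_(i-1)|^n]. These ratios telescope to
    [|K_k|^n / |V|^n = |G_k|^(-n)], which cancels the [|G_k|^n] in the number of surjections. Hence
    the only traces of [G] in the formula are [r(G_k)] and [|Aut(G)|]. The counting identities live
    in [nat], with denominators multiplied out. *)

Section FiniteCounting.

(** Every fibre over a point of [S] is a translate of the kernel. [S] is a duplicate-free list
    because [W] need not be finite. *)
Lemma card_preim_ker (U : finZmodType) (W : zmodType) (h : {additive U -> W})
  (S : seq W) :
  uniq S -> (forall c, c \in S -> exists u, h u = c) ->
  #|[set u | h u \in S]| = (#|[set u | h u == 0%R]| * size S)%N.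
Proof.
move=> uS hS; rewrite -sum1_card.
under eq_bigl do rewrite inE.
elim: S uS hS => [|c S IH] /=; first by rewrite big_pred0 // muln0.
case/andP=> cS uS hS; rewrite mulnS -IH //; last first.
  by move=> d dS; apply: hS; rewrite inE dS orbT.
rewrite (bigID (fun u => h u == c)) /=; congr (_ + _)%N; last first.
  apply: eq_bigl => u; rewrite inE; case: eqP => [->|] /=; last by rewrite andbT.
  by rewrite (negbTE cS).
have [u0 <-] := hS c (mem_head _ _).
rewrite sum1dep_card -[LHS](card_imset _ (@addIr _ (- u0)%R)).
apply: eq_card => u; rewrite !inE; apply/imsetP/idP.
  by case=> v; rewrite !inE => /andP[_ /eqP hv] ->; rewrite raddfB hv subrr.
move=> /eqP hu; exists (u + u0)%R; last by rewrite addrK.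
by rewrite !inE raddfD hu add0r eqxx.
Qed.

Lemma card_tuple_cons (T : finType) n (Q : pred (n.+1.-tuple T)) :
  #|[set t | Q t]| = (\sum_(x : T) #|[set t | Q (cons_tuple x t)]|)%N.
Proof.
rewrite -sum1_card; under eq_bigl do rewrite inE.
rewrite (partition_big (fun t => thead t) xpredT) //=.
apply: eq_bigr => x _; rewrite -sum1_card; under [RHS]eq_bigl do rewrite inE.
rewrite (reindex (cons_tuple x)) /=; last first.
  exists (fun t => behead_tuple t) => t; first by move=> _; apply: val_inj.
  by rewrite inE => /andP[_ /eqP <-]; apply: val_inj; case/tupleP: t => y t.
by apply: eq_bigl => t; rewrite theadE eqxx andbT.
Qed.

Lemma card_all_tuple (T : finType) n (A : {set T}) :
  #|[set t : n.-tuple T | all (mem A) t]| = (#|A| ^ n)%N.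
Proof.
elim: n => [|n IH].
  rewrite expn0 -(expn0 #|T|) -card_tuple -cardsT; apply: eq_card => t.
  by rewrite !inE tuple0.
rewrite card_tuple_cons (bigID (mem A)) /= [X in (_ + X)%N]big1 => [|x /negbTE xA].
  rewrite addn0 expnS -IH -sum_nat_const; apply: eq_bigr => x xA.
  by apply: eq_card => t; rewrite !inE xA.
by apply: eq_card0 => t; rewrite !inE xA.
Qed.

End FiniteCounting.

(** * Generating tuples of finite abelian p-groups *)

Section GeneratingTuples.
Local Open Scope group_scope.
Variables (gT : finGroupType) (p : nat).
Hypothesis p_pr : prime p.
Implicit Types (H K : {group gT}).

(** Both sides count the generating [(n+1)]-tuples of [F_p^(r+1)]. The first summand is for a zero
    first entry; in the second, a nonzero entry leaves an [n]-tuple that must generate modulo a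
    line. *)
Local Lemma gauss_rec n r : r <= n ->
  (\prod_(j < r.+1) (p ^ n.+1 - p ^ j) =
   \prod_(j < r.+1) (p ^ n - p ^ j)
   + (p ^ r.+1 - 1) * p ^ n * \prod_(j < r) (p ^ n - p ^ j))%N.
Proof.
move=> rn; have p0 := prime_gt0 p_pr.
have shift : (\prod_(j < r.+1) (p ^ n.+1 - p ^ j) =
    (p ^ n.+1 - 1) * p ^ r * \prod_(j < r) (p ^ n - p ^ j))%N.
  rewrite big_ord_recl expn0 -mulnA; congr (_ * _)%N.
  elim: {rn} r => [|r IH]; first by rewrite !big_ord0.
  rewrite !big_ord_recr /= IH /bump /= add1n !expnS -mulnBr.
  by rewrite mulnACA [(p ^ r * p)%N]mulnC.
rewrite shift big_ord_recr /= [X in (X + _)%N]mulnC -mulnDl; congr (_ * _)%N.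
have h1 : p ^ r <= p ^ n by rewrite leq_pexp2l.
have h2 : 0 < p ^ r by rewrite expn_gt0 p0.
have h3 : 0 < p ^ n by rewrite expn_gt0 p0.
have h4 : p ^ n <= p * p ^ r * p ^ n.
  by rewrite leq_pmull // muln_gt0 p0.
rewrite !mulnBl !mul1n !expnS; nia.
Qed.

(* Recursion on the first entry x: if x lies in K nothing changes, otherwise
   <K, x> has order p |K|. *)
Lemma card_gen_tuples_mod H K r n : abelian H -> K \subset H ->
    (forall x, x \in H -> x ^+ p \in K) -> #|H : K| = (p ^ r)%N ->
  #|[set t : n.-tuple gT | <<K :|: [set:: t]>> == H]| =
    (#|K| ^ n * \prod_(j < r) (p ^ n - p ^ j))%N.
Proof.
move=> abH; elim: n r K => [|n IH] r K sKH pK iKH.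
  have -> : [set t : 0.-tuple gT | <<K :|: [set:: t]>> == H]
     = if r == 0 then [set: 0.-tuple gT] else set0.
    apply/setP=> t; rewrite inE tuple0 set_nil setU0 genGid.
    have -> : (K :==: H) = (r == 0)%N.
      rewrite eqEsubset sKH /= -indexg_eq1 iKH -(expn0 p) eqn_exp2l //.
      exact: prime_gt1.
    by case: eqP; rewrite !inE.
  case: r {iKH} => [|r] /=; first by rewrite cardsT card_tuple big_ord0.
  (* For [r > 0] the factor [j = 0] of the product is [p^0 - p^0], in agreement with the empty tuple
     not generating. *)
  by rewrite cards0 big_ord_recl /= subnn.
rewrite card_tuple_cons (bigID (mem H)) /= [X in (_ + X)%N]big1 => [|x xH]; last first.
  apply: eq_card0 => t; rewrite !inE; apply: contraNF xH => /eqP <-.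
  by rewrite mem_gen // inE set_cons setU11 orbT.
rewrite addn0 (bigID (mem K)) /=.
rewrite (eq_bigr (fun _ => #|K| ^ n * \prod_(j < r) (p ^ n - p ^ j)))%N; last first.
  move=> x /andP[_ xK]; rewrite -(IH _ K) //; apply: eq_card => t; rewrite !inE /=.
  by rewrite set_cons setUA (setUidPl (_ : [set x] \subset K)) ?sub1set.
rewrite (eq_bigl (mem K)); last first.
  by move=> x; rewrite /= andb_idl //; apply: (subsetP sKH).
rewrite sum_nat_const (eq_bigl (mem (H :\: K))); last by move=> x; rewrite !inE andbC.
case: r iKH => [|r] iKH.
  have -> : H :\: K = set0.
    apply/eqP; rewrite setD_eq0 -indexg_eq1 iKH; exact: eqxx.
  rewrite [X in (_ + X)%N]big1 => [|x]; last by rewrite /= inE.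
  by rewrite addn0 !big_ord0 !muln1 expnS.
rewrite (eq_bigr (fun _ => (p * #|K|) ^ n * \prod_(j < r) (p ^ n - p ^ j)))%N; last first.
  move=> x /=; rewrite inE => /andP[xK xH].
  pose K' := (K <*> <[x]>)%G.
  have sK'H : K' \subset H by rewrite join_subG sKH cycle_subG.
  have nKH : H \subset 'N(K).
    exact: subset_trans (sub_abelian_cent abH sKH) (cent_sub K).
  have nKx := subsetP nKH x xH.
  have iK' : #|K' : K| = p.
    rewrite -card_quotient; last first.
      by rewrite join_subG normG cycle_subG.
    rewrite /= joingC quotientYidr ?cycle_subG // quotient_cycle // -orderE.
    apply: nt_prime_order p_pr _ _.
      by rewrite -morphX //= coset_id // pK.
    by apply: contraNneq xK => /coset_idr; apply.
  have cK' : #|K'| = (p * #|K|)%N by rewrite -(@Lagrange _ K' K) ?joing_subl // iK' mulnC.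
  rewrite -cK' -(IH r K') //.
  - apply: eq_card => t; rewrite !inE /= set_cons -!joingE.
    by rewrite -joingA joing_idl [[set x] <*> _]joingE joing_idr.
  - by move=> y yH; rewrite mem_gen // inE pK.
  apply/eqP; rewrite -(eqn_pmul2l (indexg_gt0 K' K)).
  by rewrite mulnC  Lagrange_index ?joing_subl // iKH iK' expnS.
rewrite sum_nat_const.
have -> : #|H :\: K| = (#|K| * (p ^ r.+1 - 1))%N.
  by rewrite cardsD (setIidPr sKH) -(Lagrange sKH) iKH mulnBr muln1.
case: (leqP r n) => rn.
  rewrite gauss_rec // expnMn mulnDr [(#|K| ^ n.+1)%N]expnS mulnA.
  by congr (_ + _)%N; move: (p ^ r.+1 - 1)%N => a; lia.
(* With fewer entries than the rank, the factor [j = k] makes the product vanish, and both sides are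
   zero. *)
have z (k l : nat) : k < l -> (\prod_(j < l) (p ^ k - p ^ j) = 0)%N.
  by move=> kl; rewrite (bigD1 (Ordinal kl)) //= subnn.
rewrite (z n r) // (z n r.+1) ?(z n.+1 r.+1) ?muln0 //; exact: ltnW.
Qed.

(** In an abelian p-group the Frattini subgroup is ['Mho^1(H)], and its elements are non-generators:
    adjoining it to a tuple does not change whether the tuple generates [H]. *)
Lemma card_gen_tuples H r n : abelian H -> p.-group H ->
    #|H : 'Mho^1(H)| = (p ^ r)%N ->
  #|[set t : n.-tuple gT | <<[set:: t]>> == H]| =
    (#|'Mho^1(H)| ^ n * \prod_(j < r) (p ^ n - p ^ j))%N.
Proof.
move=> abH pH iH.
have sMH := Mho_sub 1 H.
rewrite -(card_gen_tuples_mod _ abH sMH) //; last first.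
  by move=> x xH; rewrite -(expn1 p) /= Mho_p_elt // (mem_p_elt pH).
apply: eq_card => t; rewrite !inE; apply/eqP/eqP => [gH|].
  have sTH : [set:: t] \subset H by rewrite -gH subset_gen.
  apply/eqP; rewrite eqEsubset gen_subG subUset sMH sTH /=.
  by rewrite -{1}gH genS ?subsetUr.
have PhiE : 'Phi(H) = 'Mho^1(H).
  by rewrite (Phi_joing pH) (derG1P abH) joing1G.
by move=> gH; apply: Phi_nongen; rewrite PhiE.
Qed.

End GeneratingTuples.

(** * Matrices over Z/p^(e+1) with prescribed images *)

Section MatricesModPower.
Local Open Scope group_scope.
Local Open Scope ring_scope.
Variables (p : nat) (p_pr : prime p) (e n : nat).
Local Notation q := (p ^ e.+1)%N.
Local Notation Zq := 'Z_q.
Local Notation V := 'cV[Zq]_n.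

Lemma expp_gt1 : (1 < q)%N.
Proof.
apply: leq_trans (prime_gt1 p_pr) _.
by rewrite expnS leq_pmulr // expn_gt0 prime_gt0.
Qed.

Lemma Zq_modulus : (Zp_trunc q).+2 = q.
Proof. exact: Zp_cast expp_gt1. Qed.

Lemma Zq_mulrn_eq0 (x : Zq) a : (x *+ a == 0) = (q %| x * a)%N.
Proof.
by rewrite -[x in LHS]natr_Zp -mulrnA -val_eqE /= val_Zp_nat ?expp_gt1.
Qed.

Lemma Zq_torsion (x : Zq) : (x *+ p == 0) = (p ^ e %| x)%N.
Proof.
rewrite Zq_mulrn_eq0; move: (nat_of_ord x) => a.
by rewrite expnSr dvdn_pmul2r ?prime_gt0.
Qed.

Lemma mulrn_q (v : V) : v *+ q = 0.
Proof.
apply/matrixP=> i j; rewrite mulmxnE mxE; apply/eqP.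
by rewrite Zq_mulrn_eq0 dvdn_mull.
Qed.

Lemma pgroup_V (N : {group V}) : p.-group N.
Proof.
rewrite -pnat_exponent; apply: (@pnat_dvd _ q); last by rewrite pnatX pnat_id.
by apply/exponentP => v _; rewrite zmodXgE mulrn_q.
Qed.

(** An entry killed by [p] is [i * p^e] for a unique [i < p]. *)
Lemma card_torsion : #|[set v : V | v *+ p == 0]| = (p ^ n)%N.
Proof.
pose f (w : 'cV['I_p]_n) : V := map_mx (fun i : 'I_p => (i * p ^ e)%:R) w.
have fK (i : 'I_p) : nat_of_ord ((i * p ^ e)%:R : Zq) = (i * p ^ e)%N.
  rewrite val_Zp_nat ?expp_gt1 //.
  by rewrite modn_small // expnS ltn_pmul2r ?expn_gt0 ?prime_gt0.
have f_inj : injective f.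
  move=> w w' /matrixP ww; apply/matrixP => i j; have := ww i j; rewrite !mxE.
  move/(congr1 (@nat_of_ord _)); rewrite !fK => /eqP.
  by rewrite eqn_pmul2r ?expn_gt0 ?prime_gt0 // => /eqP/val_inj.
have -> : (p ^ n)%N = #|[set f w | w : 'cV['I_p]_n]|.
  by rewrite (card_imset _ f_inj) card_mx card_ord muln1.
apply: eq_card => v; rewrite inE; apply/eqP/imsetP => [vp|[w _ ->]]; last first.
  apply/matrixP => i j; rewrite mulmxnE !mxE; apply/eqP.
  by rewrite Zq_torsion fK dvdn_mull.
have dv i : (p ^ e %| v i ord0)%N.
  by move/matrixP: vp => /(_ i ord0) /eqP; rewrite mulmxnE mxE Zq_torsion.
have lt i : (v i ord0 %/ p ^ e < p)%N.
  rewrite ltn_divLR ?expn_gt0 ?prime_gt0 // -expnS.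
  by rewrite -[X in (_ < X)%N]Zq_modulus ltn_ord.
exists (\matrix_(i, j) Ordinal (lt i)); first by rewrite inE.
by apply/matrixP => i j; rewrite !mxE /= divnK //= ord1 natr_Zp.
Qed.

(** Multiplication by [p] on [N] has kernel ['Ohm_1(N)] and image ['Mho^1(N)]. A vector killed by
    [p] is a multiple of [p^e], so the hypothesis puts the whole [p]-torsion of [V] inside [N]. *)
Lemma index_Mho (N : {group V}) : (forall v : V, v *+ p ^ e \in N) ->
  #|N : 'Mho^1(N)| = (p ^ n)%N.
Proof.
move=> peN; have abN : abelian N by apply: zmod_abelian.
have pN := pgroup_V N.
rewrite -divgS ?Mho_sub // -(mul_card_Ohm_Mho_abelian 1 abN) mulnK ?cardG_gt0 //.
rewrite (OhmEabelian pN) ?(abelianS (Ohm_sub _ _)) // -card_torsion.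
apply: eq_card => v; rewrite !inE expn1 zmodXgE andb_idl // => /eqP vp.
suff [w ->] : exists w, v = w *+ p ^ e by exact: peN.
have dv i : (p ^ e %| v i ord0)%N.
  by move/matrixP: vp => /(_ i ord0) /eqP; rewrite mulmxnE mxE Zq_torsion.
exists (\matrix_(i, j) (v i ord0 %/ p ^ e)%:R); apply/matrixP => i j.
by rewrite mulmxnE !mxE ord1 -mulrnA divnK // natr_Zp.
Qed.

Definition mx_im (B : 'M[Zq]_n) : {set V} := [set B *m v | v : V].

Definition mx_cols (B : 'M[Zq]_n) : n.-tuple V := [tuple col j B | j < n].

Lemma mx_cols_bij : bijective mx_cols.
Proof.
exists (fun t : n.-tuple V => \matrix_(i, j) tnth t j i 0).
  by move=> B; apply/matrixP => i j; rewrite !mxE tnth_mktuple mxE.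
move=> t; apply: eq_from_tnth => j; rewrite tnth_mktuple.
by apply/matrixP => i k; rewrite !mxE ord1.
Qed.

(** Scalars of ['Z_q] act as natural multiples, so the subgroup generated by the columns is already
    the submodule they span. This turns matrices with a given image into generating tuples of a
    group. *)
Lemma gen_cols B : <<[set:: mx_cols B]>>%g = mx_im B.
Proof.
have gB : group_set (mx_im B).
  apply/group_setP; split=> [|_ _ /imsetP[u _ ->] /imsetP[v _ ->]].
    by apply/imsetP; exists 0; rewrite ?mulmx0.
  by rewrite zmodMgE -mulmxDr imset_f.
apply/eqP; rewrite eqEsubset; apply/andP; split.
  rewrite -[mx_im B]/(gval (group gB)) gen_subG; apply/subsetP => v; rewrite inE.
  case/mapP => j _ ->; apply/imsetP; exists (delta_mx j 0) => //.
  by rewrite -colE.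
apply/subsetP => _ /imsetP[v _ ->].
have -> : B *m v = \sum_j col j B *+ v j 0.
  apply/matrixP => i k; rewrite summxE !mxE; apply: eq_bigr => j _.
  by rewrite mulmxnE mxE -mulr_natr natr_Zp ord1.
apply: (big_ind (fun x => x \in <<[set:: mx_cols B]>>%g)) => [|x y|j _].
- exact: group1.
- exact: groupM.
rewrite -zmodXgE groupX // mem_gen // inE; apply/mapP; exists j => //.
by rewrite mem_enum.
Qed.

Lemma group_mx_im B : group_set (mx_im B).
Proof. by rewrite -gen_cols groupP. Qed.

Canonical mx_im_group B := group (group_mx_im B).

Lemma card_preim_cols (Q : pred (n.-tuple V)) :
  #|[set B | Q (mx_cols B)]| = #|[set t | Q t]|.
Proof.
have [g colsK gK] := mx_cols_bij.
rewrite -(card_imset _ (can_inj colsK)); apply: eq_card => t; rewrite inE.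
apply/imsetP/idP => [[B]|Qt]; first by rewrite inE => QB ->.
by exists (g t); rewrite ?inE gK.
Qed.

Lemma card_mx_cV : #|{: 'M[Zq]_n}| = (#|{: V}| ^ n)%N.
Proof. by rewrite !card_mx muln1 expnM. Qed.

(** [card_gen_tuples] yields the factor [|pN|^n], which is [|N|^n / p^(n * n)] by [index_Mho]. *)
Lemma card_mx_im_eq (N : {group V}) : (forall v : V, v *+ p ^ e \in N) ->
  (#|[set B | mx_im B == N]| * p ^ (n * n) =
   #|N| ^ n * \prod_(j < n) (p ^ n - p ^ j))%N.
Proof.
move=> peN; have iN := index_Mho peN.
have -> : [set B | mx_im B == N] = [set B | <<[set:: mx_cols B]>>%g == N].
  by apply/setP => B; rewrite !inE gen_cols.
rewrite (card_preim_cols (fun t => <<[set:: t]>>%g == N)).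
rewrite (card_gen_tuples p_pr _ (zmod_abelian _) (pgroup_V N) iN).
by rewrite -(Lagrange (Mho_sub 1 N)) iN expnMn -expnM mulnAC.
Qed.

Lemma card_mx_im_sub (K : {group V}) :
  #|[set B | mx_im B \subset K]| = (#|K| ^ n)%N.
Proof.
rewrite -card_all_tuple -card_preim_cols; apply: eq_card => B; rewrite !inE.
rewrite -gen_cols gen_subG; apply/subsetP/allP => h x; last by rewrite inE => /h.
by move=> xB; apply: h; rewrite inE.
Qed.

Lemma mx_im_subP (B C : 'M[Zq]_n) :
  reflect (exists D, B *m D = C) (mx_im C \subset mx_im B).
Proof.
apply: (iffP idP) => [/subsetP sCB|[D <-]]; last first.
  by apply/subsetP => _ /imsetP[v _ ->]; rewrite -mulmxA imset_f.
have /fin_all_exists[d dE] : forall j, exists v, col j C = B *m v.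
  move=> j; have /sCB/imsetP[v _ ->] : col j C \in mx_im C by rewrite colE imset_f.
  by exists v.
exists (\matrix_(i, j) d j i 0); apply/matrixP => i j.
move/matrixP: (dE j) => /(_ i 0); rewrite !mxE => ->.
by apply: eq_bigr => l _; rewrite !mxE.
Qed.

(** Left multiplication by [P] sends matrices onto those with image inside [mx_im P], of which there
    are [|mx_im P|^n]. So each fibre has [|V|^n / |mx_im P|^n] elements, and there are as many
    fibres as matrices with image [N]. *)
Lemma card_mulmx_im_eq (P : 'M[Zq]_n) (N : {group V}) :
    (forall v : V, v *+ p ^ e \in N) -> N \subset mx_im P ->
  (#|[set B | mx_im (P *m B) == N]| * #|mx_im P| ^ n * p ^ (n * n) =
   #|{: V}| ^ n * #|N| ^ n * \prod_(j < n) (p ^ n - p ^ j))%N.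
Proof.
move=> peN sNP.
have cS (S : {set 'M[Zq]_n}) : (forall C, C \in S -> mx_im C \subset mx_im P) ->
    #|[set B | P *m B \in S]| = (#|[set B : 'M[Zq]_n | P *m B == 0%R]| * #|S|)%N.
  move=> hS; rewrite [#|S|]cardE -(@card_preim_ker _ _ (mulmx P) _ (enum_uniq S)).
    by apply: eq_card => B; rewrite !inE mem_enum.
  by move=> C; rewrite mem_enum => /hS /mx_im_subP.
have E1 : [set B | P *m B \in [set C | mx_im C == N]] =
    [set B | mx_im (P *m B) == N] by apply/setP => B; rewrite !inE.
have E2 : [set B | P *m B \in [set C | mx_im C \subset mx_im P]] = setT.
  by apply/setP => B; rewrite !inE; apply/mx_im_subP; exists B.
have := cS [set C | mx_im C == N]; rewrite E1 => -> //; last first.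
  by move=> C; rewrite inE => /eqP ->.
have := cS [set C | mx_im C \subset mx_im P]; rewrite E2 cardsT card_mx_cV.
rewrite card_mx_im_sub => -> //; last by move=> C; rewrite inE.
rewrite -[RHS]mulnA -card_mx_im_eq //.
by rewrite -!mulnA; congr (_ * _)%N; rewrite mulnCA.
Qed.

(** The initial factor [P] is there for the induction: once the first matrix [B] is chosen, the
    others solve the same problem for [P *m B] and the shifted chain. The orders of the intermediate
    [K i] telescope. *)
Lemma card_prefix_im (k : nat) (K : nat -> {group V}) (P : 'M[Zq]_n) :
    (forall i, (i < k)%N -> K i.+1 \subset K i) ->
    (forall i (v : V), v *+ p ^ e \in K i) -> mx_im P = K 0 ->
  (#|[set A : k.-tuple 'M[Zq]_n |
      [forall i : 'I_k, mx_im (P *m \prod_(j < i.+1) A`_j) == K i.+1]]|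
     * #|K 0| ^ n * (p ^ (n * n)) ^ k =
   (#|{: V}| ^ n) ^ k * #|K k| ^ n * (\prod_(j < n) (p ^ n - p ^ j)) ^ k)%N.
Proof.
elim: k K P => [|k IH] K P sK peK PK.
  have -> : [set A : 0.-tuple 'M[Zq]_n |
      [forall i : 'I_0, mx_im (P *m \prod_(j < i.+1) A`_j) == K i.+1]] = setT.
    by apply/setP => t; rewrite !inE; apply/forallP => -[].
  by rewrite cardsT card_tuple !expn0 !muln1.
rewrite card_tuple_cons (bigID (fun B => mx_im (P *m B) == K 1)) /=.
rewrite [X in (_ + X)%N]big1 ?addn0 => [|B]; last first.
  move/negbTE => PB; apply: eq_card0 => t; rewrite !inE.
  by apply/forallP => /(_ ord0); rewrite big_ord_recl big_ord0 mulr1 PB.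
pose c := ((#|{: V}| ^ n) ^ k * #|K k.+1| ^ n * (\prod_(j < n) (p ^ n - p ^ j)) ^ k)%N.
have cB B : mx_im (P *m B) == K 1 ->
    (#|[set A : k.-tuple 'M[Zq]_n | [forall i : 'I_k.+1,
       mx_im (P *m \prod_(j < i.+1) (cons_tuple B A)`_j) == K i.+1]]|
     * #|K 1| ^ n * (p ^ (n * n)) ^ k = c)%N.
  move=> PB; rewrite /c -[K k.+1]/((fun i => K i.+1) k).
  rewrite -(IH (fun i => K i.+1) (P *m B)) => [|i ik|i v|]; first last.
  - exact/eqP.
  - exact: peK.
  - exact: sK.
  apply: (congr1 (fun z : {set k.-tuple 'M[Zq]_n} =>
    #|z| * #|K 1| ^ n * (p ^ (n * n)) ^ k)%N).
  apply: eq_finset => A; apply/forallP/forallP => h i.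
    by have := h (lift ord0 i); rewrite big_ord_recl /= mulmxA /bump /= add1n.
  case: (unliftP ord0 i) => [j ->|->]; last by rewrite big_ord_recl big_ord0 mulr1.
  by have := h j; rewrite [in X in _ -> X]big_ord_recl /= mulmxA.
have sumE (s : 'M[Zq]_n -> nat) a : (forall B, mx_im (P *m B) == K 1 -> s B * a = c)%N ->
    ((\sum_(B | mx_im (P *m B) == K 1%N) s B) * a =
     #|[set B | mx_im (P *m B) == K 1%N]| * c)%N.
  move=> sB; rewrite big_distrl /= (eq_bigr (fun _ => c)) //.
  by rewrite sum_nat_const; congr (_ * _)%N; apply: eq_card => B; rewrite !inE.
set s := (X in (X * _ * _)%N).
have {sumE} sE : (s * (#|K 1| ^ n * (p ^ (n * n)) ^ k) =
    #|[set B | mx_im (P *m B) == K 1%N]| * c)%N.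
  by apply: sumE => B /cB; rewrite mulnA.
have := @card_mulmx_im_eq P (K 1) (peK 1); rewrite PK => /(_ (sK 0 isT)) dE.
(* [|K 1|^n] is the term that telescopes: a denominator in the induction hypothesis, a numerator in
   the count of first matrices. *)
apply/eqP; rewrite -(@eqn_pmul2r (#|K 1| ^ n)) ?expn_gt0 ?cardG_gt0 //; apply/eqP.
have E1 (a b r d f : nat) : (a * b * (r * d) * f = a * (f * d) * (b * r))%N by lia.
have E2 (a b r d f g h : nat) : (a * (b * r * d) * (f * h) = b * r * (d * (a * f * h)))%N.
  by lia.
have E3 (a b r d f g : nat) : (a * b * (d * (f * r * g)) = f * a * b * (g * d) * r)%N.
  by lia.
by rewrite (expnS (p ^ (n * n))) E1 sE E2 // dE E3 -!expnS.
Qed.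

End MatricesModPower.

From mathcomp Require Import all_classical all_reals all_analysis.

Import numFieldNormedType.Exports.

(** * Residues of p-adic integers and reduction modulo p^(e+1) *)

Section PadicResidues.
Local Open Scope ring_scope.
Variables (p : nat) (p_pr : prime p).
Local Notation Zp := (padic p_pr).
Local Notation pw m := ((p ^ m)%N%:Z).

Lemma expp_neq0 m : pw m != 0.
Proof. by rewrite eqz_nat -lt0n expn_gt0 prime_gt0. Qed.

Lemma residue_ge0 (x : Zp) m : 0 <= x m.
Proof. by rewrite -residue_mod modz_ge0 // expp_neq0. Qed.

Lemma residue_lt (x : Zp) m : x m < pw m.
Proof. by rewrite -residue_mod ltz_pmod // lt0r expp_neq0. Qed.

Lemma residueD (x : Zp) m d : x m = (x (m + d)%N %% pw m)%Z.
Proof.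
elim: d => [|d IH]; first by rewrite addn0 residue_mod.
rewrite IH addnS [in LHS]residueS; set a := x _.
have E : (a %/ pw (m + d))%Z * pw (m + d) = (a %/ pw (m + d))%Z * pw d * pw m.
  by rewrite -mulrA -PoszM -expnD addnC.
by rewrite [in RHS](divz_eq a (pw (m + d))) E modzMDl.
Qed.

Lemma residue_nat a m : (a%:R : Zp) m = (a%:Z %% pw m)%Z.
Proof.
elim: a => [|a IH] //.
by rewrite mulrS /= IH modzDm -PoszD.
Qed.

(** Bezout gives an inverse modulo each [p^m]; inverses modulo [p^m] are unique, which makes these
    residues compatible. *)
Lemma padic_unit (x : Zp) : x 1%N != 0 -> exists u, x * u = 1.
Proof.
move=> x1.
have cop m : coprimez (x m) (pw m).
  case: m => [|m]; first by rewrite expn0 coprimezE coprimen1.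
  rewrite coprimezE /= coprimeXr // coprime_sym prime_coprime //.
  apply: contra x1; rewrite -[p in (p %| _)%N]/(`|p%:Z|%N) -dvdzE => px.
  rewrite (residueD x 1 m) add1n expn1; exact/eqP/dvdz_mod0P.
pose u m := (egcdz (x m) (pw m)).1.
have xu m : (x m * u m = 1 %[mod pw m])%Z.
  rewrite /u; case: egcdzP => a b /= ab _; move: ab.
  have /eqP -> := cop m => <-.
  by rewrite -modzDmr modzMl addr0 mulrC.
have uP m : (u m.+1 = u m %[mod pw m])%Z.
  apply/eqP; rewrite eqz_mod_dvd -(Gauss_dvdzr (n := x m)); last first.
    by rewrite coprimez_sym.
  rewrite mulrBr -eqz_mod_dvd xu [x m]residueS modzMml.
  have := congr1 (fun a => (a %% pw m)%Z) (xu m.+1).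
  by rewrite !modzMpow => ->.
exists (padic_of p_pr uP); apply: padicP => m /=.
by rewrite modzMmr xu.
Qed.

(** Division by [p^m] loses [m] digits, so the residue of the quotient modulo [p^l] is read off
    level [l + m] of [x]. *)
Lemma dvd_padic (x : Zp) m : x m = 0 -> exists y : Zp, x = (p ^ m)%:R * y.
Proof.
move=> xm.
have dx l : (pw m %| x (l + m)%N)%Z.
  by apply/dvdz_mod0P; rewrite addnC -residueD.
have yP l : ((x (l.+1 + m)%N %/ pw m)%Z = (x (l + m)%N %/ pw m)%Z %[mod pw l])%Z.
  apply/eqP; rewrite eqz_mod_dvd -(dvdz_mul2r (p := pw m)) ?expp_neq0 //.
  rewrite mulrBl !divzK // -PoszM -expnD -eqz_mod_dvd addSn.
  by rewrite [x (l + m)%N]residueS modz_mod.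
exists (padic_of p_pr yP); apply: padicP => l /=.
rewrite residue_nat modzMmr modzMml mulrC divzK //.
exact: residueD.
Qed.

Variable e : nat.
Local Notation q := (p ^ e.+1)%N.
Local Notation Zq := 'Z_q.

Definition red (x : Zp) : Zq := (x e.+1)%:~R.

Lemma intr_mod_q (a : int) : (a %% pw e.+1)%Z%:~R = a%:~R :> Zq.
Proof.
rewrite [a in RHS](divz_eq _ (pw e.+1)) [in RHS]intrD [in RHS]intrM.
by rewrite [(pw e.+1)%:~R]pchar_Zp ?expp_gt1 // mulr0 add0r.
Qed.

Lemma red_is_zmod_morphism : zmod_morphism red.
Proof.
by move=> x y; rewrite /red /= intr_mod_q intrD intr_mod_q intrN.
Qed.

Lemma red_is_monoid_morphism : monoid_morphism red.
Proof.
by split=> [|x y]; rewrite /red /= intr_mod_q // intrM.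
Qed.

HB.instance Definition _ := GRing.isZmodMorphism.Build Zp Zq red red_is_zmod_morphism.
HB.instance Definition _ := GRing.isMonoidMorphism.Build Zp Zq red red_is_monoid_morphism.

Lemma redK (v : Zq) : red (v : nat)%:R = v.
Proof. by rewrite rmorph_nat natr_Zp. Qed.

Lemma red_eq0P (x : Zp) : red x = 0 <-> exists y : Zp, x = q%:R * y.
Proof.
split=> [|[y ->]]; last by rewrite rmorphM rmorph_nat /= pchar_Zp ?expp_gt1 ?mul0r.
move=> rx; apply: dvd_padic; move: rx; rewrite /red.
have := residue_lt x e.+1; have := residue_ge0 x e.+1.
case: (x e.+1) => // a _; rewrite ltz_nat => aq /(congr1 (@nat_of_ord _)).
by rewrite /= -pmulrn val_Zp_nat ?expp_gt1 // modn_small // => ->.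
Qed.

End PadicResidues.

(** * Nakayama's lemma and kernels modulo p^(e+1) *)

Section Reduction.
Local Open Scope ring_scope.
Variables (p : nat) (p_pr : prime p).
Local Notation Zp := (padic p_pr).

Lemma red0_neq0 (x : Zp) : red 0 x != 0 -> x 1%N != 0.
Proof. by apply: contraNneq => x1; rewrite /red x1. Qed.

(** [red 0] is reduction modulo [p^1]; it sends the matrix to the identity, so the determinant is a
    unit. *)
Lemma det_1subMp n (Y : 'M[Zp]_n) : exists u, \det (1%:M - Y *+ p) * u = 1.
Proof.
apply: padic_unit; apply: red0_neq0.
rewrite -det_map_mx map_mxB map_mx1 raddfMn /=.
suff -> : (map_mx (red 0) Y) *+ p = 0 by rewrite subr0 det1 oner_neq0.
apply/matrixP => i j; rewrite mulmxnE !mxE -mulr_natr -[p in p%:R]expn1.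
by rewrite pchar_Zp ?mulr0 // expp_gt1.
Qed.

Variable e : nat.
Local Notation q := (p ^ e.+1)%N.
Local Notation Zq := 'Z_q.
Local Notation redq := (@red p p_pr e).

(* If p^e 1 = P X + p^(e+1) Y, then p^e (1 - p Y) = P X, and 1 - p Y is
   invertible since its determinant is 1 mod p. *)
Lemma mx_Nakayama n (P : 'M[Zp]_n) :
    (forall w : 'cV[Zp]_n, exists u y, w *+ p ^ e = P *m u + y *+ q) ->
  forall w : 'cV[Zp]_n, exists u, w *+ p ^ e = P *m u.
Proof.
move=> hP.
have /boolp.choice[X /boolp.choice[Y XY]] : forall j, exists u y : 'cV[Zp]_n,
  (delta_mx j 0 : 'cV[Zp]_n) *+ p ^ e = P *m u + y *+ q by move=> j; apply: hP.
pose MX := \matrix_(i, j) X j i 0; pose MY := \matrix_(i, j) Y j i 0.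
have E : (1%:M - MY *+ p) *+ p ^ e = P *m MX.
  apply/matrixP => i j; have /matrixP/(_ i 0) := XY j.
  rewrite !(mulmxnE, mxE) eqxx andbT mulrnBl => ->; rewrite -mulrnA -expnS addrK.
  by apply: eq_bigr => l _; rewrite mxE.
have [u du] := det_1subMp MY.
have En B : (1%:M - MY *+ p) *m B *+ p ^ e = (P *m MX) *m B.
  by rewrite -E; apply/esym/(raddfMn (mulmxr B)).
move=> w; exists (MX *m (\adj (1%:M - MY *+ p) *m (u *: w))).
by rewrite mulmxA -En mulmxA mul_mx_adj mul_scalar_mx scalerA du scale1r.
Qed.

Variable n : nat.
Local Notation W := 'cV[Zp]_n.
Local Notation V := 'cV[Zq]_n.

Lemma map_mx_redK a b (v : 'M[Zq]_(a, b)) :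
  map_mx redq (\matrix_(i, j) (v i j : nat)%:R) = v.
Proof. by apply/matrixP => i j; rewrite !mxE redK. Qed.

Lemma map_mx_red_eq0 (w : W) : map_mx redq w = 0 -> exists y : W, w = y *+ q.
Proof.
move=> /matrixP rw.
have /boolp.choice[y yE] : forall j, exists y : Zp, w j 0 = q%:R * y.
  by move=> j; apply/red_eq0P; have := rw j 0; rewrite !mxE.
exists (\matrix_(j, _) y j); apply/matrixP => i j.
by rewrite mulmxnE mxE ord1 yE mulr_natl.
Qed.

Variable H : lmodType Zp.
Hypothesis Hq : forall x : H, x *+ p ^ e = 0.

Definition lincomb (t : 'I_n -> H) (w : W) : H := \sum_j w j 0 *: t j.

Lemma lincomb_is_linear t : linear (lincomb t).
Proof.
move=> a u v; rewrite /lincomb scaler_sumr -big_split; apply: eq_bigr => j _ /=.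
by rewrite !mxE scalerDl scalerA.
Qed.

HB.instance Definition _ t :=
  GRing.isLinear.Build Zp W H *:%R (lincomb t) (lincomb_is_linear t).

Lemma lincomb_delta t j : lincomb t (delta_mx j 0) = t j.
Proof.
rewrite /lincomb (bigD1 j) //= mxE !eqxx scale1r big1 ?addr0 // => i ij.
by rewrite mxE (negbTE ij) scale0r.
Qed.

Lemma linear_lincomb (f : {linear W -> H}) w :
  f w = lincomb (fun j => f (delta_mx j 0)) w.
Proof.
rewrite {1}[w]matrix_sum_delta raddf_sum; apply: eq_bigr => j _.
by rewrite big_ord1 /= linearZ.
Qed.

(** The map induced by [lincomb t] on residues. [H] carries no ['Z_q]-module structure, so a residue
    acts by multiples of its representative; additivity relies on [q] killing [H]. *)
Definition lincomb_mod (t : 'I_n -> H) (v : V) : H := \sum_j t j *+ v j 0.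

Lemma mulrn_killed (x : H) : x *+ q = 0.
Proof. by rewrite expnSr mulrnA Hq mul0rn. Qed.

Lemma scale_red (a : Zp) (x : H) : a *: x = x *+ redq a.
Proof.
rewrite -scaler_nat; apply/eqP; rewrite -subr_eq0 -scalerBl.
have [|y ->] := (red_eq0P e (a - (redq a : nat)%:R)).1.
  by rewrite rmorphB /= redK subrr.
by rewrite mulrC -scalerA scaler_nat mulrn_killed scaler0.
Qed.

Lemma lincomb_mod_is_zmod_morphism t : zmod_morphism (lincomb_mod t).
Proof.
move=> u v; rewrite /lincomb_mod -sumrB; apply: eq_bigr => j _.
rewrite !mxE; move: (u j 0) (v j 0) => a b.
by rewrite -[a]redK -[b]redK -rmorphB -!scale_red scalerBl.
Qed.

Lemma lincomb_mod_red t (w : W) : lincomb_mod t (map_mx redq w) = lincomb t w.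
Proof. by apply: eq_bigr => j _; rewrite mxE scale_red. Qed.

HB.instance Definition _ t := GRing.isZmodMorphism.Build V H (lincomb_mod t)
  (lincomb_mod_is_zmod_morphism t).

Lemma lincomb_mod0 t : lincomb_mod t 0 = 0.
Proof. exact: raddf0. Qed.

Lemma lincomb_modD t u v : lincomb_mod t (u + v) = lincomb_mod t u + lincomb_mod t v.
Proof. exact: raddfD. Qed.

Lemma lincomb_modMn t v a : lincomb_mod t (v *+ a) = lincomb_mod t v *+ a.
Proof. exact: raddfMn. Qed.

(** Equality modulo [q] only says that every [w] in the kernel is [P *m u + y *+ q] for some [u] and
    [y]. But [p^e Zp^n] is contained in the kernel, so [mx_Nakayama] puts it inside the image of
    [P], and this absorbs the error [y *+ q], which is [p^e] times [y *+ p]. *)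
Lemma ker_lincomb_mod (t : 'I_n -> H) (P : 'M[Zp]_n) :
  (forall w : W, lincomb t w = 0 <-> exists u, w = P *m u) <->
  mx_im (map_mx redq P) = [set v | lincomb_mod t v == 0].
Proof.
split=> [kP|kP w].
  apply/setP => v; rewrite inE; apply/imsetP/eqP => [[u _ ->]|].
    rewrite -(map_mx_redK u) -map_mxM lincomb_mod_red; apply/kP.
    by eexists.
  rewrite -(map_mx_redK v) lincomb_mod_red => /kP[u ->].
  by exists (map_mx redq u); rewrite ?map_mxM.
have kM (x : W) : lincomb t x = 0 <-> map_mx redq x \in mx_im (map_mx redq P).
  by rewrite kP inE lincomb_mod_red; split=> /eqP.
have lift (x : W) : lincomb t x = 0 -> exists u y, x = P *m u + y *+ q.
  move=> /kM/imsetP[v _]; rewrite -(map_mx_redK v) -map_mxM => /eqP.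
  rewrite -subr_eq0 -map_mxB => /eqP/map_mx_red_eq0[y xy].
  by exists (\matrix_(i, j) (v i j : nat)%:R), y; rewrite -xy addrC subrK.
split=> [|[u ->]]; last by apply/kM; rewrite map_mxM imset_f.
move=> /lift[u [y ->]].
have [|x xE] := @mx_Nakayama n P _ (y *+ p).
  by move=> x; apply: lift; rewrite raddfMn Hq.
by exists (u + x); rewrite mulmxDr -xE -mulrnA -expnS.
Qed.

End Reduction.

(** * Bases of finitely generated vector spaces *)

Section FiniteDimension.
Local Open Scope ring_scope.

(** A generating family of minimal length is a basis: a relation with a nonzero coefficient at [i]
    would allow [g i] to be eliminated. *)
Lemma finite_basis (F : fieldType) (E : lmodType F) : finitely_generated E ->
  exists r (e : 'I_r -> E), bijective (fun c : 'rV[F]_r => \sum_(i < r) c 0 i *: e i).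
Proof.
move=> [m0 [g0 g0E]].
pose Q m := `[< exists g : 'I_m -> E, forall x, exists c : 'I_m -> F,
  x = \sum_(i < m) c i *: g i >].
have exQ : exists m, Q m by exists m0; apply/asboolP; exists g0.
case: (ex_minnP exQ) => m /asboolP[g gE] min_m.
exists m, g; set comb := (fun c : 'rV[F]_m => _).
have combB c d : comb (c - d) = comb c - comb d.
  rewrite /comb -sumrB; apply: eq_bigr => i _.
  by rewrite !mxE scalerBl.
have comb_inj : injective comb.
  move=> c d cd; apply/eqP; rewrite -subr_eq0; set b := c - d.
  have : comb b = 0 by rewrite combB cd subrr.
  apply: contra_eqT => /rV0Pn[i].
  case: m => [|m] in g gE min_m comb combB c d cd b i *; first by case: i.
  move=> bi0; apply/eqP => b0.
  have /min_m : Q m; last by rewrite ltnn.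
  apply/asboolP; exists (fun j => g (lift i j)) => x.
  have [a ->] := gE x.
  exists (fun j => a (lift i j) - a i * (b 0 i)^-1 * b 0 (lift i j)).
  under [RHS]eq_bigr do rewrite scalerBl -scalerA.
  rewrite sumrB -scaler_sumr (bigD1_ord i) //= addrC; congr (_ + _).
  move: b0; rewrite /comb (bigD1_ord i) //= => /eqP; rewrite addr_eq0 => /eqP b0.
  by rewrite -scalerN -b0 scalerA mulfVK.
have /boolp.choice[k kE] : forall x, exists c, x = comb c.
  move=> x; have [c ->] := gE x; exists (\row_i c i).
  by apply: eq_bigr => i _; rewrite mxE.
exists k => [c|x]; last by rewrite -kE.
by apply: comb_inj; rewrite -kE.
Qed.

(** Finite generation guarantees that [vdim] is the length of a basis and not the default value of
    [xget]. *)
Lemma vdimP (F : fieldType) (E : lmodType F) : finitely_generated E ->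
  exists e : 'I_(vdim E) -> E,
    bijective (fun c : 'rV[F]_(vdim E) => \sum_(i < vdim E) c 0 i *: e i).
Proof. by move=> /finite_basis exb; exact: (xgetPex 0%N exb). Qed.

End FiniteDimension.

(** * Finite modules as finite groups *)

Section FiniteType.
Local Open Scope ring_scope.
Variables (R : pzRingType) (H : lmodType R).

(* A copy of a module with finitely many elements, which can thus carry a
   finType structure. *)
Definition finmod (_ : finite_set [set: H]) : Type := H.

Variable finH : finite_set [set: H].
Local Notation HF := (finmod finH).

HB.instance Definition _ := GRing.Lmodule.on HF.

Let s : seq HF := undup (projT1 (boolp.cid ((finite_seqP _).1 finH))).

Let mem_s (x : HF) : x \in s.
Proof.
rewrite mem_undup; case: boolp.cid => /= l lE.
by have : [set: H]%classic x := I; rewrite lE.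
Qed.

Let s_pickleK : pcancel (fun x : HF => index x s) (fun i => onth s i).
Proof. by move=> x; rewrite (onthE s) (nth_map x) ?nth_index ?index_mem. Qed.

HB.instance Definition _ := PCanIsCountable s_pickleK.

Let s_enumP : Finite.axiom s.
Proof. by move=> x; rewrite count_uniq_mem ?undup_uniq // mem_s. Qed.

HB.instance Definition _ := fintype.isFinite.Build HF s_enumP.

HB.instance Definition _ := [finGroupMixin of HF for +%R].

End FiniteType.

(** * Finite modules over the p-adic integers *)

Section FiniteModules.
Local Open Scope group_scope.
Local Open Scope ring_scope.
Variables (p : nat) (p_pr : prime p).
Local Notation Zp := (padic p_pr).
Variables (H : lmodType Zp) (finH : finite_set [set: H]).
Local Notation HF := (finmod finH).

(** The order of [H] kills [H], and its prime-to-[p] part is a unit of [Zp]. *)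
Lemma finmod_killed : exists e, forall x : H, x *+ p ^ e = 0.
Proof.
have o0 : (0 < #|[set: HF]%SET|)%N by rewrite (cardD1 0) inE.
have [m cpm cE] := pfactor_coprime p_pr o0.
exists (logn p #|[set: HF]%SET|) => x.
have [u mu] : exists u : Zp, m%:R * u = 1.
  apply: padic_unit; rewrite residue_nat expn1 modz_nat eqz_nat.
  by rewrite -/(dvdn p m) -prime_coprime.
have xN : ((x : HF) ^+ #|[set: HF]%SET| = 1)%g.
  by rewrite expg_cardG // inE.
rewrite -[LHS]scale1r -mu mulrC -scalerA scaler_nat -mulrnA mulnC -cE.
by rewrite [X in u *: X](xN : x *+ _ = 0) scaler0.
Qed.

Lemma finmod_pgroup : p.-group [set: HF].
Proof.
have [e He] := finmod_killed.
rewrite -pnat_exponent; apply: (@pnat_dvd _ (p ^ e)); last first.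
  by rewrite pnatX pnat_id.
by apply/exponentP => v _; apply: He.
Qed.

Lemma quotp_fg : finitely_generated (quotp H).
Proof.
exists #|{: HF}|, (fun i => quotmod_pi (pmul_submod H) (enum_val i : HF)) => x.
exists (fun i => (i == enum_rank (quotmod_repr x : HF))%:R).
rewrite (bigD1 (enum_rank (quotmod_repr x : HF))) //= eqxx scale1r enum_rankK.
rewrite big1 ?addr0 => [|i /negbTE ->]; last by rewrite scale0r.
by rewrite quotmod_reprK.
Qed.

(** ['Mho^1] is [pH], the kernel of [h], which reads the coordinates of a class of [H / pH] in a
    basis over [F_p] and is onto. *)
Lemma finmod_index_Mho : #|[set: HF] : 'Mho^1([set: HF])| = (p ^ prank H)%N.
Proof.
have [b [g bK gK]] := vdimP quotp_fg.
rewrite -/(prank H) in b g bK gK.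
pose pi : H -> quotp H := quotmod_pi (pmul_submod H).
have piB x y : pi (x - y) = pi x - pi y by exact: raddfB.
have gB u v : g (u - v) = g u - g v.
  apply: (can_inj bK); rewrite gK -[in LHS](gK u) -[in LHS](gK v) -sumrB.
  by apply: eq_bigr => i _; rewrite !mxE scalerBl.
pose h (x : HF) := g (pi x).
have hB : zmod_morphism h by move=> x y; rewrite /h -gB -piB.
pose ha : {additive HF -> 'rV['F_p]_(prank H)} :=
  HB.pack h (GRing.isZmodMorphism.Build _ _ h hB).
have := @card_preim_ker _ _ ha (enum [set: _]) (enum_uniq _).
rewrite -[size _]cardE cardsT card_mx mul1n card_Fp // => cardH.
have {}cardH : #|[set: HF]| = (#|[set u | ha u == 0%R]| * p ^ prank H)%N.
  rewrite -cardH => [|c _]; first by apply: eq_card => x; rewrite !inE mem_enum inE.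
  have [x xE] : exists x, pi x = \sum_(i < prank H) c 0 i *: b i.
    by exists (quotmod_repr (\sum_(i < prank H) c 0 i *: b i)); apply: quotmod_reprK.
  by exists x; rewrite /= /h xE bK.
rewrite -divgS ?Mho_sub // cardH /=.
suff -> : 'Mho^1([set: HF]) = [set u | ha u == 0].
  rewrite mulKn //; apply/card_gt0P; exists 0; rewrite inE; apply/eqP.
  exact: (raddf0 ha).
rewrite (MhoEabelian _ finmod_pgroup (zmod_abelian _)).
have g0 : g 0 = 0 by rewrite -(subrr 0) gB subrr.
have pi0 x : pi x = 0 <-> exists y : H, x = p%:R *: y.
  have <- : pi 0 = 0 by rewrite -(subrr 0) piB subrr.
  have pP := quotmod_piP (pmul_submod H) x 0; rewrite subr0 in pP.
  by split=> [/pP/asboolP|hx] //; apply/pP/asboolP.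
apply/setP => x; rewrite inE; apply/imsetP/eqP => [[y _ ->]|].
  rewrite expn1 /= /h -[RHS]g0; congr g; apply/pi0.
  by exists y; rewrite scaler_nat.
rewrite /= /h -[RHS]g0 => /(can_inj gK)/pi0[y ->].
by exists y; rewrite ?inE // expn1 scaler_nat.
Qed.

Variables (e n : nat).
Hypothesis He : forall x : H, x *+ p ^ e = 0.
Local Notation q := (p ^ e.+1)%N.
Local Notation V := 'cV['Z_q]_n.

Lemma gen_lincomb_mod (t : n.-tuple HF) :
  <<[set:: t]>>%g = [set (lincomb_mod (tnth t : 'I_n -> H) v : HF) | v : V].
Proof.
pose f : V -> HF := lincomb_mod (tnth t : 'I_n -> H).
have f0 : f 0 = 0 by exact: (lincomb_mod0 He).
have fD u v : f (u + v) = f u + f v by exact: (lincomb_modD He).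
rewrite -[RHS]/[set f v | v : V].
have gB : group_set [set f v | v : V].
  apply/group_setP; split=> [|_ _ /imsetP[u _ ->] /imsetP[v _ ->]].
    by apply/imsetP; exists 0.
  by apply/imsetP; exists (u + v).
apply/eqP; rewrite finset.eqEsubset; apply/andP; split.
  rewrite -[[set f v | v : V]]/(gval (group gB)) gen_subG.
  apply/fintype.subsetP => v; rewrite inE.
  case/tnthP => j ->; apply/imsetP; exists (delta_mx j 0) => //.
  rewrite /f /lincomb_mod (bigD1 j) //= mxE !eqxx big1 ?addr0 // => i ij.
  by rewrite mxE (negbTE ij).
apply/fintype.subsetP => _ /imsetP[v _ ->].
apply: (big_ind (fun x : HF => x \in <<[set:: t]>>%g)) => [|x y|j _].
- exact: group1.
- exact: groupM.
by rewrite -[_ *+ _]/(tnth t j ^+ _)%g groupX // mem_gen // inE mem_tnth.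
Qed.

(** Since [Zp] acts on [H] through [Z/p^(e+1)], generating [H] as a group and as a [Zp]-module are
    the same. *)
Lemma gen_tuple_surjP (t : n.-tuple HF) :
  <<[set:: t]>>%g = [set: HF] <->
  forall x : H, exists w, lincomb (tnth t : 'I_n -> H) w = x.
Proof.
rewrite gen_lincomb_mod; split=> [tT x|ht].
  have : (x : HF) \in [set: HF] by rewrite inE.
  rewrite -tT => /imsetP[v _ ->].
  exists (\matrix_(i, j) (v i j : nat)%:R).
  by rewrite -(lincomb_mod_red (e := e)) // map_mx_redK.
apply/setP => x; rewrite inE; apply/imsetP; have [w <-] := ht x.
by exists (map_mx (red e) w); rewrite ?lincomb_mod_red.
Qed.

Lemma card_ker_lincomb_mod (t : n.-tuple HF) : <<[set:: t]>>%g = [set: HF] ->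
  #|{: V}| = (#|[set v : V | lincomb_mod (tnth t : 'I_n -> H) v == 0%R]| * #|{: HF}|)%N.
Proof.
move=> tT; pose f : V -> HF := lincomb_mod (tnth t : 'I_n -> H).
have fB : zmod_morphism f by exact: lincomb_mod_is_zmod_morphism.
pose fa : {additive V -> HF} := HB.pack f (GRing.isZmodMorphism.Build _ _ f fB).
have := @card_preim_ker _ _ fa (enum [set: _]) (enum_uniq _).
rewrite -cardE cardsT => <- => [|x _].
  by apply: eq_card => v; rewrite !inE mem_enum inE.
have : x \in [set: HF] by rewrite inE.
by rewrite -tT gen_lincomb_mod => /imsetP[v _ ->]; exists v.
Qed.

Lemma card_generating (m : nat) :
  (#|[set t : m.-tuple HF | <<[set:: t]>>%g == [set: HF]]| * p ^ (prank H * m) =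
   #|{: HF}| ^ m * \prod_(j < prank H) (p ^ m - p ^ j))%N.
Proof.
rewrite (card_gen_tuples p_pr _ (zmod_abelian _) finmod_pgroup finmod_index_Mho).
rewrite -cardsT -(Lagrange (Mho_sub 1 [set: HF])) finmod_index_Mho.
by rewrite expnMn -expnM mulnAC.
Qed.

End FiniteModules.

(** * Induction from the top index of a flag *)

Section DownwardInduction.
Variable k : nat.
Implicit Types i j : 'I_k.+1.

(** These arithmetic facts are named because their proofs occur inside the terms built by
    [flag_proj_rec] and [flag_proj]. *)
Local Lemma eq_max i : k = (0 + i)%N -> ord_max = i.
Proof. by move=> ki; apply: val_inj. Qed.

Local Lemma lt_succ d i : k = (d.+1 + i)%N -> (i.+1 < k.+1)%N.
Proof. lia. Qed.

Local Lemma eq_succ d i : k = (d.+1 + i)%N -> k = (d + i.+1)%N.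
Proof. lia. Qed.

Local Lemma eq_sub i : k = (k - i + i)%N.
Proof. by rewrite subnK // -ltnS. Qed.

Lemma ord_down_ind (Q : 'I_k.+1 -> Prop) : Q ord_max ->
  (forall i j : 'I_k.+1, j = i.+1 :> nat -> Q j -> Q i) -> forall i, Q i.
Proof.
move=> Qmax Qstep i.
have [d] : exists d, k = (d + i)%N by exists (k - i)%N; apply: eq_sub.
elim: d i => [|d IH] i ki; first by rewrite -(eq_max ki).
exact: Qstep (IH (Ordinal (lt_succ ki)) (eq_succ ki)).
Qed.

End DownwardInduction.

(** * The composite projections from the top of a flag *)

Section FlagProjections.
Local Open Scope ring_scope.
Variables (p : nat) (p_pr : prime p) (k : nat) (F : flag p_pr k.+1).
Local Notation Zp := (padic p_pr).

(** The recursion is on the distance [d] from the top. At distance 0 the index [i] equals [ord_max]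
    only propositionally, hence the transport. *)
Fixpoint flag_proj_rec (d : nat) : forall i : 'I_k.+1, k = (d + i)%N ->
    {linear F ord_max -> F i} :=
  match d with
  | 0 => fun i ki => eq_rect ord_max (fun j => {linear F ord_max -> F j})
                       (idfun : {linear F ord_max -> F ord_max}) i (eq_max ki)
  | d'.+1 => fun i ki =>
     (@flag_map _ _ _ F i (Ordinal (lt_succ ki)) erefl
       \o @flag_proj_rec d' (Ordinal (lt_succ ki)) (eq_succ ki)
       : {linear F ord_max -> F i})
  end.

Definition flag_proj i : {linear F ord_max -> F i} := flag_proj_rec (eq_sub i).

Lemma flag_projE d (i : 'I_k.+1) (ki : k = (d + i)%N) x :
  flag_proj i x = flag_proj_rec ki x.
Proof.
have di : d = (k - i)%N by lia.
move: ki; rewrite di => ki; rewrite /flag_proj.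
by congr (flag_proj_rec _ x); apply: eq_irrelevance.
Qed.

Lemma flag_proj_max x : flag_proj ord_max x = x.
Proof.
rewrite (@flag_projE 0 ord_max erefl) /=.
by rewrite (eq_irrelevance (eq_max _) erefl).
Qed.

Lemma flag_proj_map (i j : 'I_k.+1) (ij : j = i.+1 :> nat) x :
  flag_map F ij (flag_proj j x) = flag_proj i x.
Proof.
(* The distance is written as a successor so that the recursion unfolds once, to the index [j]. *)
have ki : k = ((k - j).+1 + i)%N by have := ltn_ord j; lia.
have jE : j = Ordinal (lt_succ ki) by apply: val_inj.
rewrite (flag_projE ki) /= -(flag_projE).
move: (lt_succ ki) jE => lt jE; subst j.
by rewrite (eq_irrelevance ij erefl).
Qed.

Lemma flag_proj_surj i (y : F i) : exists x, flag_proj i x = y.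
Proof.
move: i y; apply: ord_down_ind => [y|i j ij IH y].
  by exists y; rewrite flag_proj_max.
have [z <-] := flag_surj ij y; have [x <-] := IH z.
by exists x; rewrite flag_proj_map.
Qed.

End FlagProjections.

Arguments flag_proj_map {p p_pr k} F {i j} ij x.
Arguments flag_proj_surj {p p_pr k} F {i} y.

(** * Isomorphisms of flags *)

Section FlagIsomorphisms.
Local Open Scope ring_scope.
Variables (p : nat) (p_pr : prime p) (k : nat).
Local Notation Zp := (padic p_pr).

Lemma flag_iso_comp (F F' F'' : flag p_pr k) s s' :
  flag_iso F F' s -> flag_iso F' F'' s' -> flag_iso F F'' (fun i => s' i \o s i).
Proof.
move=> [sl [sb sm]] [sl' [sb' sm']]; split; [|split] => [i a x y|i|i j ij x] /=.
- by rewrite sl sl'.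
- exact: bij_comp (sb' i) (sb i).
- by rewrite sm' sm.
Qed.

Lemma flag_iso_inv (F F' : flag p_pr k) s : flag_iso F F' s ->
  exists2 s', flag_iso F' F s' & forall i x, s' i (s i x) = x.
Proof.
move=> [sl [sb sm]].
have /all_sig[g gP] : forall i, {g : F' i -> F i | cancel (s i) g /\ cancel g (s i)}.
  by move=> i; apply: boolp.cid; case: (sb i) => g sK gK; exists g.
exists g; last by move=> i; apply: (gP i).1.
have inj i : injective (s i) by exact: bij_inj (sb i).
split; [|split] => [i a x y|i|i j ij x].
- by apply: (inj i); rewrite sl !(gP _).2.
- by exists (s i); [apply: (gP i).2|apply: (gP i).1].
- by apply: (inj i); rewrite -sm !(gP _).2.
Qed.

Lemma flag_iso_proj (F F' : flag p_pr k.+1) s : flag_iso F F' s ->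
  forall i x, s i (flag_proj F i x) = flag_proj F' i (s ord_max x).
Proof.
move=> [_ [_ sm]]; apply: ord_down_ind => [x|i j ij IH x].
  by rewrite !flag_proj_max.
by rewrite -(flag_proj_map F ij) -(flag_proj_map F' ij) -sm IH.
Qed.

End FlagIsomorphisms.

(** * Markings and isomorphisms of the cokernel flag with G *)

Section CokernelMarkings.
Local Open Scope ring_scope.
Variables (p : nat) (p_pr : prime p) (k n : nat) (G : flag p_pr k.+1).
Local Notation Zp := (padic p_pr).
Local Notation W := 'cV[Zp]_n.
Implicit Types (M : 'I_k.+1 -> 'M[Zp]_n) (t : 'I_n -> G ord_max).

(* t defines a surjection Zp^n -> G_k under which the flag of the quotients
   Zp^n / im (M_1 ... M_i) corresponds to G. *)
Definition marking M t : Prop :=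
  (forall x, exists w, lincomb t w = x) /\
  forall i (w : W), flag_proj G i (lincomb t w) = 0 <->
                    exists u, w = mx_prefix M i *m u.

Local Notation pi M i := (quotmod_pi (im_submod (mx_prefix M i))).

Lemma cok_flag_proj M i (w : W) :
  flag_proj (cok_flag M) i (pi M ord_max w) = pi M i w.
Proof.
move: i; apply: ord_down_ind => [|i j ij IH]; first exact: flag_proj_max.
by rewrite -(flag_proj_map (cok_flag M) ij) IH; apply: quotmod_map_pi.
Qed.

Lemma cok_pi_eq0 M i (w : W) : pi M i w = 0 <-> exists u, w = mx_prefix M i *m u.
Proof.
rewrite -(raddf0 (pi M i)); have pP := quotmod_piP (im_submod (mx_prefix M i)) w 0.
rewrite subr0 in pP.
by split=> [/pP/asboolP|hw] //; apply/pP/asboolP.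
Qed.

Lemma iso_lincomb M s : flag_iso (cok_flag M) G s -> forall w,
  lincomb (fun j => s ord_max (pi M ord_max (delta_mx j 0))) w =
  s ord_max (pi M ord_max w).
Proof.
move=> [sl _] w; pose f w := s ord_max (pi M ord_max w).
have fl : linear f by move=> a u v; rewrite /f linearP sl.
pose fa : {linear W -> G ord_max} := HB.pack f (GRing.isLinear.Build _ _ _ _ f fl).
exact/esym/(linear_lincomb fa).
Qed.

Lemma iso_marking M s : flag_iso (cok_flag M) G s ->
  marking M (fun j => s ord_max (pi M ord_max (delta_mx j 0))).
Proof.
move=> s_iso; have := s_iso; move=> [sl [sb sm]]; split=> [x|i w].
  have [g sK gK] := sb ord_max.
  exists (quotmod_repr (g x)); rewrite iso_lincomb // -[RHS]gK.
  by congr (s _ _); apply: quotmod_reprK.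
rewrite iso_lincomb // -(flag_iso_proj s_iso) cok_flag_proj -cok_pi_eq0.
have s0 : s i 0 = 0.
  (* Linearity with scalar -1 and both vectors zero gives [s i 0 = - s i 0 + s i 0]. *)
  by have := sl i (-1) 0 0; rewrite scaler0 addr0 scaleN1r addNr.
split=> [|->] //; rewrite -[X in _ = X -> _]s0; exact: (bij_inj (sb i)).
Qed.

(** The kernel condition makes [s i] both independent of the representative and injective. The
    equation for [ord_max] lets the marking be recovered from the isomorphism. *)
Lemma marking_iso M t : marking M t -> exists2 s, flag_iso (cok_flag M) G s &
  forall w, s ord_max (pi M ord_max w) = lincomb t w.
Proof.
move=> [tsurj tker].
pose s i (x : cok_flag M i) : G i := flag_proj G i (lincomb t (quotmod_repr x)).
have sE i w : s i (pi M i w) = flag_proj G i (lincomb t w).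
  apply/eqP; rewrite /s eq_sym -subr_eq0 -raddfB /= -raddfB /=; apply/eqP/tker/cok_pi_eq0.
  by rewrite raddfB /= quotmod_reprK subrr.
exists s; last by move=> w; rewrite sE flag_proj_max.
have repr i (x : cok_flag M i) : exists w, x = pi M i w.
  by exists (quotmod_repr x); rewrite quotmod_reprK.
split; [|split] => [i a x y|i|i j ij x].
- have [u ->] := repr i x; have [v ->] := repr i y.
  have <- : pi M i (a *: u + v) = a *: pi M i u + pi M i v by exact: linearP.
  by rewrite !sE; rewrite [lincomb t _]linearP linearP.
- have /boolp.choice[g gE] : forall y : G i, exists x, s i x = y.
    move=> y; have [x <-] := flag_proj_surj G y; have [w <-] := tsurj x.
    by exists (pi M i w).
  have sI : injective (s i).
    move=> x y; have [u ->] := repr i x; have [v ->] := repr i y.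
    rewrite !sE => /eqP; rewrite -subr_eq0 -raddfB /= -raddfB /= => /eqP/tker/cok_pi_eq0.
    by rewrite raddfB /= => /eqP; rewrite subr_eq0 => /eqP.
  by exists g => // x; apply: sI.
have [w ->] := repr j x; rewrite sE flag_proj_map.
have -> : flag_map (cok_flag M) ij (pi M j w) = pi M i w by exact: quotmod_map_pi.
by rewrite sE.
Qed.

End CokernelMarkings.

(** * Counting automorphisms by markings *)

Lemma ncard_bij (T : Type) (A : set T) (U : finType) (S : {set U}) (f : T -> U) :
    (forall x, A x -> f x \in S) ->
    (forall x y, A x -> A y -> f x = f y -> x = y) ->
    (forall u, u \in S -> exists2 x, A x & f x = u) ->
  ncard A = #|S|.
Proof.
move=> fS f_inj f_surj.
have AS : (A #= `I_#|S|)%card.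
  apply/card_set_bijP; exists (fun x => index (f x) (enum S)); split.
  - by move=> x /fS; rewrite /= cardE index_mem mem_enum.
  - move=> x y /set_mem Ax /set_mem Ay fxy; apply: f_inj => //.
    have fe z : A z -> f z \in enum S by rewrite mem_enum; apply: fS.
    by rewrite -(nth_index (f x) (fe x Ax)) fxy nth_index // fe.
  move=> m /=; rewrite cardE => mS.
  have u0 : U by case: (enum S) mS => [|u].
  have : nth u0 (enum S) m \in S by rewrite -mem_enum mem_nth.
  move=> /f_surj[x Ax fx]; exists x => //.
  by rewrite fx index_uniq // enum_uniq.
have exm : exists m, [set m | (A #= `I_m)%card]%classic m by exists #|S|.
have := xgetPex 0%N exm; rewrite -/(ncard A) /= card_eq_sym => Am.
by apply/card_eq_II; apply: card_eq_trans Am AS.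
Qed.

Section MarkingCount.
Local Open Scope ring_scope.
Variables (p : nat) (p_pr : prime p) (k n : nat) (G : flag p_pr k.+1).
Hypothesis finG : finite_set [set: G ord_max].
Local Notation Zp := (padic p_pr).
Local Notation HF := (finmod finG).

(** The bijection composes an automorphism with [t0]. It is onto because two markings give two
    isomorphisms from the same cokernel flag to [G], which differ by an automorphism. *)
Lemma card_markings (M : 'I_k.+1 -> 'M[Zp]_n) (t0 : 'I_n -> G ord_max) :
    marking M t0 ->
  ncard (flag_Aut G) =
    #|[set t : n.-tuple HF | `[< marking M (tnth t : 'I_n -> G ord_max) >] ]|.
Proof.
move=> mt0; have [s0 s0_iso s0E] := marking_iso mt0.
have [s0' s0'_iso s0K] := flag_iso_inv s0_iso.
have s0_delta j : s0 ord_max (quotmod_pi _ (delta_mx j 0)) = t0 j.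
  by rewrite s0E lincomb_delta.
pose f (s : forall i, G i -> G i) : n.-tuple HF :=
  [tuple (s ord_max (t0 j) : HF) | j < n].
have tnth_f s : (tnth (f s) : 'I_n -> G ord_max) = fun j => s ord_max (t0 j).
  by apply/boolp.funext => j; rewrite tnth_mktuple.
apply: (ncard_bij (f := f)) => [s s_iso|s s' s_iso s'_iso ss'|t].
- rewrite inE; apply/asboolP; rewrite tnth_f.
  have := iso_marking (flag_iso_comp s0_iso s_iso).
  by congr (marking M _); apply/boolp.funext => j /=; rewrite s0_delta.
- have {}ss' j : s ord_max (t0 j) = s' ord_max (t0 j).
    by rewrite -[LHS](congr1 (@^~ j) (tnth_f s)) ss' tnth_f.
  have max_eq x : s ord_max x = s' ord_max x.
    have [w <-] := mt0.1 x.
    have := iso_lincomb (flag_iso_comp s0_iso s_iso) w.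
    have := iso_lincomb (flag_iso_comp s0_iso s'_iso) w.
    rewrite /= s0E => <- <-; congr (lincomb _ w); apply/boolp.funext => j.
    by rewrite s0_delta.
  (* The component at [ord_max] determines the others, since each [flag_proj] is onto and commutes
     with isomorphisms. *)
  apply/functional_extensionality_dep => i; apply/boolp.funext => y.
  have [x <-] := flag_proj_surj G y.
  by rewrite (flag_iso_proj s_iso) (flag_iso_proj s'_iso) max_eq.
rewrite inE => /asboolP mt; have [s s_iso sE] := marking_iso mt.
exists (fun i => s i \o s0' i); first exact: flag_iso_comp s0'_iso s_iso.
apply: eq_from_tnth => j; rewrite tnth_mktuple /= -s0_delta s0K sE.
exact: lincomb_delta.
Qed.

End MarkingCount.

(** * Double counting of marked tuples modulo p^(e+1) *)

Section DoubleCounting.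
Local Open Scope ring_scope.
Variables (p : nat) (p_pr : prime p) (k n e : nat) (G : flag p_pr k.+1).
Hypothesis finG : finite_set [set: G ord_max].
Hypothesis He : forall x : G ord_max, x *+ p ^ e = 0.
Local Notation Zp := (padic p_pr).
Local Notation HF := (finmod finG).
Local Notation q := (p ^ e.+1)%N.
Local Notation Zq := 'Z_q.
Local Notation V := 'cV[Zq]_n.
Implicit Types (A : k.+1.-tuple 'M[Zq]_n) (t : n.-tuple HF).

Lemma flag_killed i (x : G i) : x *+ p ^ e = 0.
Proof. by have [y <-] := flag_proj_surj G x; rewrite -raddfMn He raddf0. Qed.

Definition marking_ker t i : {set V} :=
  [set v : V | lincomb_mod (fun j => flag_proj G i (tnth t j : G ord_max)) v == 0].

(** The factor [1%:M] plays the role of [P] in [card_prefix_im]. *)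
Definition marking_mod A t : bool :=
  (<<[set:: t]>>%g == [set: HF]) &&
  [forall i : 'I_k.+1, mx_im (1%:M *m \prod_(j < i.+1) A`_j) == marking_ker t i].

Lemma map_mx_prefix (M : 'I_k.+1 -> 'M[Zp]_n) A :
    (forall i, map_mx (red e) (M i) = tnth A i) ->
  forall i : 'I_k.+1, map_mx (red e) (mx_prefix M i) = \prod_(j < i.+1) A`_j.
Proof.
move=> MA i; rewrite (big_ord_widen k.+1 (fun j => A`_j)) //.
rewrite /mx_prefix (big_morph (map_mx (red e)) (@map_mxM _ _ _ _ _ _) (map_mx1 _ _)).
by apply: eq_big => j; rewrite ?ltnS // MA (tnth_nth 0).
Qed.

Lemma marking_modP (M : 'I_k.+1 -> 'M[Zp]_n) A t :
    (forall i, map_mx (red e) (M i) = tnth A i) ->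
  marking M (tnth t : 'I_n -> G ord_max) <-> marking_mod A t.
Proof.
move=> MA; rewrite /marking_mod.
have lin i w : flag_proj G i (lincomb (tnth t : 'I_n -> G ord_max) w) =
    lincomb (fun j => flag_proj G i (tnth t j : G ord_max)) w.
  by rewrite raddf_sum; apply: eq_bigr => j _; rewrite /= linearZ.
have ker i : (forall w : 'cV[Zp]_n,
    flag_proj G i (lincomb (tnth t : 'I_n -> G ord_max) w) = 0 <->
    exists u, w = mx_prefix M i *m u) <->
    mx_im (1%:M *m \prod_(j < i.+1) A`_j) = marking_ker t i.
  rewrite mul1mx -(map_mx_prefix MA) -(ker_lincomb_mod (@flag_killed i)).
  by split=> h w; have := h w; rewrite lin.
split=> [[/(gen_tuple_surjP He) -> tker]|
         /andP[/eqP/(gen_tuple_surjP He) gt /forallP tker]].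
  by rewrite eqxx; apply/forallP => i; apply/eqP/ker => w; apply: tker.
by split=> // i; apply/ker/eqP.
Qed.

Lemma group_marking_ker t i : group_set (marking_ker t i).
Proof.
apply/group_setP; split=> [|u v]; first by rewrite inE (lincomb_mod0 (@flag_killed i)).
rewrite !inE => /eqP fu /eqP fv.
by rewrite (lincomb_modD (@flag_killed i)) fu fv addr0.
Qed.

Canonical marking_ker_group t i := group (group_marking_ker t i).

Lemma lincomb_mod_proj t i (v : V) :
  lincomb_mod (fun j => flag_proj G i (tnth t j : G ord_max)) v =
  flag_proj G i (lincomb_mod (tnth t : 'I_n -> G ord_max) v).
Proof. by rewrite raddf_sum; apply: eq_bigr => j _; rewrite raddfMn. Qed.

(** In [card_prefix_im] the chain runs from [V] to the kernel of the map onto [G_k], whose index is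
    [|G_k|]: after telescoping, only [|G_k|^n] remains as a denominator. *)
Lemma card_marking_mod t : <<[set:: t]>>%g = [set: HF] ->
  (#|[set A | marking_mod A t]| * #|{: HF}| ^ n * (p ^ (n * n)) ^ k.+1 =
   (#|{: V}| ^ n) ^ k.+1 * (\prod_(j < n) (p ^ n - p ^ j)) ^ k.+1)%N.
Proof.
move=> tT.
(* Flag indices start at 0, so the chain is shifted by one to make room for [V] in front; [inord]
   merely makes [K] total on [nat]. *)
pose K i : {group V} := if i is i'.+1 then marking_ker_group t (inord i') else [set: V]%G.
have K_sub i : (i < k.+1)%N -> K i.+1 \subset K i.
  case: i => [|i] ik; first by rewrite finset.subsetT.
  apply/fintype.subsetP => v; rewrite !inE !lincomb_mod_proj => /eqP fv.
  have ij : (inord i.+1 : 'I_k.+1) = (inord i : 'I_k.+1).+1 :> nat.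
    by rewrite !inordK // ltnW.
  by rewrite -(flag_proj_map G ij) fv raddf0.
have K_pe i (v : V) : v *+ p ^ e \in K i.
  case: i => [|i]; first by rewrite inE.
  by rewrite inE (lincomb_modMn (@flag_killed _)) flag_killed.
have im1 : mx_im 1%:M = K 0.
  apply/setP => v; rewrite inE; apply/imsetP; exists v => //.
  by rewrite mul1mx.
have := card_prefix_im p_pr K_sub K_pe im1.
have -> : [set A : k.+1.-tuple 'M[Zq]_n | [forall i : 'I_k.+1,
      mx_im (1%:M *m \prod_(j < i.+1) A`_j) == K i.+1]] = [set A | marking_mod A t].
  apply: eq_finset => A; rewrite /marking_mod tT eqxx /=.
  by apply: eq_forallb => i; rewrite /= inord_val.
have -> : #|K 0%N| = #|{: V}| by rewrite -cardsT.
rewrite {1}(card_ker_lincomb_mod He tT).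
have -> : [set v : V | lincomb_mod (tnth t : 'I_n -> G ord_max) v == 0] = K k.+1.
  apply/setP => v; rewrite !inE lincomb_mod_proj.
  have -> : inord k = ord_max :> 'I_k.+1 by apply: val_inj; rewrite /= inordK.
  by rewrite flag_proj_max.
have c0 : (0 < #|K k.+1| ^ n)%N by rewrite expn_gt0 cardG_gt0.
rewrite expnMn => E; apply/eqP; rewrite -(eqn_pmul2r c0); apply/eqP; move: E.
move: #|[set A | _]| (#|K k.+1| ^ n)%N (#|{: HF}| ^ n)%N => a c d E.
transitivity (a * (c * d) * (p ^ (n * n)) ^ k.+1)%N; first by rewrite -!mulnA; lia.
by rewrite E mulnAC.
Qed.

Definition good_mod : {set k.+1.-tuple 'M[Zq]_n} := [set A | [exists t, marking_mod A t]].

Lemma card_good_mod :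
  (#|good_mod| * ncard (flag_Aut G) * p ^ (prank (G ord_max) * n) * (p ^ (n * n)) ^ k.+1 =
   (#|{: V}| ^ n) ^ k.+1 * (\prod_(j < n) (p ^ n - p ^ j)) ^ k.+1 *
   \prod_(j < prank (G ord_max)) (p ^ n - p ^ j))%N.
Proof.
have AutE A : A \in good_mod -> #|[set t | marking_mod A t]| = ncard (flag_Aut G).
  rewrite inE => /existsP[t At].
  (* Any lift of [A] would do, since markings depend only on residues; a lift is what
     [card_markings] applies to. *)
  pose M i : 'M[Zp]_n := \matrix_(a, b) (tnth A i a b : nat)%:R.
  have MA i : map_mx (red e) (M i) = tnth A i by apply: map_mx_redK.
  rewrite (card_markings finG ((marking_modP _ MA).2 At)).
  apply: eq_card => t'; rewrite !inE.
  by apply/idP/asboolP => /(marking_modP t' MA).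
have dc : (#|good_mod| * ncard (flag_Aut G) = \sum_t #|[set A | marking_mod A t]|)%N.
  rewrite -sum_nat_const.
  under eq_bigr => A /AutE <- do rewrite -sum1dep_card.
  rewrite (eq_bigl (fun A => [exists t, marking_mod A t])); last by move=> A; rewrite inE.
  rewrite (exchange_big_dep xpredT) //=; apply: eq_bigr => t _.
  rewrite -sum1dep_card; apply: eq_bigl => A; rewrite andb_idl // => At.
  by apply/existsP; exists t.
pose gen := [set t : n.-tuple HF | <<[set:: t]>>%g == [set: HF]].
rewrite dc (bigID (mem gen)) /= [X in (_ + X)%N]big1 ?addn0 => [|t]; last first.
  rewrite inE => /negbTE tN; apply: eq_card0 => A.
  by rewrite inE /marking_mod tN.
set c := (\prod_(j < prank _) _)%N.
have cg := card_generating finG n; rewrite -/gen -/c in cg.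
have H0 : (0 < #|{: HF}| ^ n)%N.
  by rewrite expn_gt0; apply/orP; left; apply/card_gt0P; exists 0.
set s := (\sum_(t in gen) _)%N.
pose b := ((#|{: V}| ^ n) ^ k.+1 * (\prod_(j < n) (p ^ n - p ^ j)) ^ k.+1)%N.
rewrite -/b.
have sE : (s * #|{: HF}| ^ n * (p ^ (n * n)) ^ k.+1 = #|gen| * b)%N.
  rewrite /s !big_distrl /= -sum_nat_const; apply: eq_bigr => t; rewrite inE => /eqP.
  exact: card_marking_mod.
(* [|G_k|^n] is a denominator in the count of matrices and a numerator in [card_generating], so it
   cancels. *)
apply/eqP; rewrite -(eqn_pmul2r H0); apply/eqP; move: sE cg.
move: (#|{: HF}| ^ n)%N (p ^ _)%N (_ ^ k.+1)%N #|gen| b c s => x y z g b c s sE cg.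
transitivity (s * x * z * y)%N; first by lia.
rewrite sE; transitivity (g * y * b)%N; first by lia.
by rewrite cg; lia.
Qed.

End DoubleCounting.

(** * Haar measure of residue classes of matrices *)

Section FiniteAdditivity.
Local Open Scope classical_set_scope.
Local Open Scope ring_scope.

Lemma measure_bigcup_finset (R : realType) d (T : measurableType d)
    (mu : {measure set T -> \bar R}) (I : finType) (S : {set I}) (F : I -> set T) :
    (forall i, measurable (F i)) -> (forall i j x, F i x -> F j x -> i = j) ->
  mu (\bigcup_(i in [set` S]) F i) = (\sum_(i in S) mu (F i))%E.
Proof.
move=> mF disj.
have -> : [set` S] = [set` enum S] by apply/seteqP; split=> i; rewrite /= mem_enum.
rewrite measure_fin_bigcup //; last by move=> i j _ _ [x [Fi Fj]]; exact: disj Fi Fj.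
by rewrite -fsbig_seq ?enum_uniq // big_enum.
Qed.

End FiniteAdditivity.

Section Cylinders.
Local Open Scope classical_set_scope.
Local Open Scope ring_scope.
Variables (p : nat) (p_pr : prime p) (n e : nat).
Local Notation Zp := (padic p_pr).
Local Notation Zq := 'Z_(p ^ e.+1).

Definition cylinder (A : 'M[Zq]_n) : set (borel_mx p_pr n) :=
  [set X : 'M[Zp]_n | map_mx (red e) X = A].

Lemma measurable_cylinder A : measurable (cylinder A).
Proof.
apply: sub_sigma_algebra; rewrite openE => X XA.
exists (fun i j => [set y : Zp | red e y = red e (X i j)]) => [i j|Y XY].
  apply: open_nbhs_nbhs; split=> //.
  by move=> x xX; exists e.+1 => y yx; rewrite /= -xX /red yx.
rewrite /cylinder /= -XA; apply/matrixP => i j; rewrite !mxE.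
exact: XY.
Qed.

Lemma cylinder_disj A B X : cylinder A X -> cylinder B X -> A = B.
Proof. by move=> <-. Qed.

(** Cylinders are translates of each other by lifts of residue matrices, and they partition the
    whole space, of mass 1. *)
Lemma haar_cylinder (R : realType) d (T : measurableType d) (P : probability T R)
    (X : {RV P >-> borel_mx p_pr n}) (A : 'M[Zq]_n) : haar_random X ->
  P (X @^-1` cylinder A) = ((#|{: 'M[Zq]_n}|%:R)^-1)%:E :> \bar R.
Proof.
move=> hX; pose mu : probability (borel_mx p_pr n) R := distribution P X.
have muE B : mu (cylinder B) = mu (cylinder 0).
  pose L : 'M[Zp]_n := \matrix_(i, j) (B i j : nat)%:R.
  have LB : map_mx (red e) L = B by apply: map_mx_redK.
  rewrite -[RHS](hX L) //; last exact: measurable_cylinder.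
  congr (mu _); apply/seteqP; split=> [Y YB|_ [Y Y0 <-]].
    exists (Y - L); last by rewrite subrK.
    by rewrite /cylinder /= map_mxB YB LB subrr.
  by rewrite /cylinder /= map_mxD Y0 LB add0r.
have : mu setT = (\sum_(B in [set: 'M[Zq]_n]%SET) mu (cylinder B))%E.
  rewrite -measure_bigcup_finset; last exact: cylinder_disj.
    congr (mu _); apply/seteqP; split=> // Y _.
    by exists (map_mx (red e) (Y : 'M[Zp]_n)); rewrite //= inE.
  exact: measurable_cylinder.
have cE : mu (cylinder 0) = (fine (mu (cylinder 0)))%:E.
  by rewrite fineK // fin_num_measure //; apply: measurable_cylinder.
rewrite probability_setT (eq_bigr (fun=> (fine (mu (cylinder 0)))%:E)) => [|B _].
  rewrite sumEFin sumr_const cardsT => -[/esym E].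
  rewrite -mulr_natl in E; rewrite (mulr1_eq E).
  by rewrite -cE -[LHS]/(mu (cylinder A)) muE.
by rewrite muE.
Qed.

End Cylinders.

(** * The event as a finite union of residue classes *)

Section CokernelEvent.
Local Open Scope ring_scope.
Variables (R : realType) (p : nat) (p_pr : prime p) (k n e : nat).
Variables (G : flag p_pr k.+1) (finG : finite_set [set: G ord_max]).
Hypothesis He : forall x : G ord_max, x *+ p ^ e = 0.
Local Notation Zp := (padic p_pr).
Local Notation HF := (finmod finG).
Local Notation Zq := 'Z_(p ^ e.+1).

(** Reading the event off residues gives both its measurability and its probability. *)
Lemma cok_isoP (M : 'I_k.+1 -> 'M[Zp]_n) :
  flag_isomorphic (cok_flag M) G <->
  [tuple map_mx (red e) (M i) | i < k.+1] \in good_mod n e finG.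
Proof.
set A := [tuple _ | i < _].
have MA i : map_mx (red e) (M i) = tnth A i by rewrite tnth_mktuple.
rewrite inE; split=> [[s s_iso]|/existsP[t /(marking_modP He t MA)]]; last first.
  by move=> /marking_iso[s s_iso _]; exists s.
have mt := iso_marking s_iso; set t0 := (fun j => _) in mt.
apply/existsP; exists [tuple (t0 j : HF) | j < n].
apply/(marking_modP He _ MA); move: mt; congr (marking M _).
by apply/boolp.funext => j; rewrite tnth_mktuple.
Qed.

Local Open Scope classical_set_scope.
Variables (d : measure_display) (T : measurableType d) (P : probability T R).
Variable M : 'I_k.+1 -> {RV P >-> borel_mx p_pr n}.
Hypothesis M_haar : forall i, haar_random (M i).
Hypothesis M_indep : mutually_independent M.

Let ev (A : k.+1.-tuple 'M[Zq]_n) : set T :=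
  \bigcap_(i in [set` [set: 'I_k.+1]%SET]) M i @^-1` cylinder (tnth A i).

Let evE A t : ev A t <-> [tuple map_mx (red e) (M i t : 'M[Zp]_n) | i < k.+1] = A.
Proof.
split=> [At|<- i _]; last by rewrite /= tnth_mktuple.
apply: eq_from_tnth => i; rewrite tnth_mktuple; apply: At.
by rewrite /= inE.
Qed.

Let measurable_ev A : measurable (ev A).
Proof.
apply: fin_bigcap_measurable => [|i _]; first exact: finite_finset.
by apply: measurable_funPTI; apply: measurable_cylinder.
Qed.

Let cok_eventE : cok_event M G = \bigcup_(A in [set` good_mod n e finG]) ev A.
Proof.
apply/seteqP; split=> t.
  move=> /cok_isoP At; exists [tuple map_mx (red e) (M i t : 'M[Zp]_n) | i < k.+1] => //.
  exact/evE.
by move=> [A Agood /evE AE]; apply/cok_isoP; rewrite AE.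
Qed.

Lemma measurable_cok_event : measurable (cok_event M G).
Proof.
by rewrite cok_eventE; apply: fin_bigcup_measurable => //; exact: finite_finset.
Qed.

Lemma probability_cok_event :
  P (cok_event M G) =
  ((#|good_mod n e finG|)%:R * (#|{: 'M[Zq]_n}|%:R ^- k.+1))%:E.
Proof.
rewrite cok_eventE measure_bigcup_finset // => [|A B t /evE <- /evE //].
rewrite (eq_bigr (fun=> (#|{: 'M[Zq]_n}|%:R ^- k.+1)%:E)) => [|A _].
  by rewrite sumEFin sumr_const mulr_natl.
have mA i : measurable (cylinder (tnth A i)) by apply: measurable_cylinder.
transitivity (\prod_(i in [set: 'I_k.+1]%SET) P (M i @^-1` cylinder (tnth A i)))%E.
  exact: M_indep.
under eq_bigr do rewrite (haar_cylinder _ (M_haar _)).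
by rewrite prodEFin prodr_const cardsT card_ord exprVn.
Qed.

End CokernelEvent.

(** * The closed formula and its limit *)

Section Formula.
Local Open Scope classical_set_scope.
Local Open Scope ring_scope.
Variables (R : realType) (p : nat) (p_pr : prime p).

Lemma prod_tail_ord n r : (r <= n)%N ->
  \prod_((n - r).+1 <= i < n.+1) (1 - p%:R ^- i) =
  \prod_(j < r) (1 - p%:R ^- (n - j)) :> R.
Proof.
elim: r => [|r IH] rn; first by rewrite subn0 big_geq // big_ord0.
rewrite big_ord_recr /= -IH 1?ltnW // subnSK // big_ltn 1?mulrC //.
by rewrite ltnS leq_subr.
Qed.

(** Each factor is [p^n (1 - p^(-(n - j)))]; [r <= n] ensures that no subtraction is truncated. *)
Lemma natr_prod_expB n r : (r <= n)%N ->
  (\prod_(j < r) (p ^ n - p ^ j))%N%:R =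
  (p ^ (r * n))%N%:R * \prod_((n - r).+1 <= i < n.+1) (1 - p%:R ^- i) :> R.
Proof.
move=> rn; have p0 : p%:R != 0 :> R by rewrite pnatr_eq0 -lt0n prime_gt0.
rewrite prod_tail_ord // mulnC expnM natrX -[r in X in X * _]card_ord -prodr_const.
rewrite -big_split /= natr_prod; apply: eq_bigr => j _.
have jn : (j <= n)%N by rewrite ltnW // (leq_trans (ltn_ord j)).
rewrite natrB ?leq_exp2l ?prime_gt1 // mulrBr mulr1 !natrX; congr (_ - _).
have -> : p%:R ^+ n = p%:R ^+ j * p%:R ^+ (n - j) :> R by rewrite -exprD subnKC.
by rewrite mulfK // expf_neq0.
Qed.

Lemma prod_expB_gt0 n r : (r <= n)%N -> (0 < \prod_(j < r) (p ^ n - p ^ j))%N.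
Proof.
move=> rn; apply: prodn_gt0 => j.
by rewrite subn_gt0 ltn_exp2l ?prime_gt1 // (leq_trans (ltn_ord j)).
Qed.

Lemma probability_cok_formula (k n : nat) (G : flag p_pr k.+1)
    (finG : finite_set [set: G ord_max]) (d : measure_display)
    (T : measurableType d) (P : probability T R)
    (M : 'I_k.+1 -> {RV P >-> borel_mx p_pr n}) :
    (prank (G ord_max) <= n)%N ->
    (forall i, haar_random (M i)) -> mutually_independent M ->
  measurable (cok_event M G) /\
  P (cok_event M G) =
     ((ncard (flag_Aut G))%:R^-1
      * (\prod_((n - prank (G ord_max)).+1 <= i < n.+1) (1 - p%:R ^- i))
      * (\prod_(1 <= i < n.+1) (1 - p%:R ^- i)) ^+ k.+1)%:E.
Proof.
move=> rn M_haar M_indep; have [e He] := finmod_killed finG.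
split; first exact: (measurable_cok_event finG He).
rewrite (probability_cok_event finG He M_haar M_indep); congr EFin.
have := card_good_mod n finG He; rewrite -card_mx_cV.
set g := #|good_mod n e finG|; set N := #|_|; set a := ncard _; set r := prank _.
have N0 : (0 < N)%N by apply/card_gt0P; exists 0.
have c0 := prod_expB_gt0 rn; have f0 := prod_expB_gt0 (leqnn n).
(* The right side of [E] is positive because [r <= n]. This excludes [a = 0], the default value of
   [ncard] for an infinite set, and permits division by [a]. *)
move=> E; have a0 : a != 0%N.
  apply/eqP => a0; move: E; rewrite a0 muln0 !mul0n => /esym/eqP.
  by rewrite !muln_eq0 !expn_eq0 !gtn_eqF.
have {E} := congr1 (fun m : nat => m%:R : R) E.
rewrite !natrM (natrX _ N) (natrX _ (p ^ (n * n))) (natrX _ (\prod_(j < n) _)%N).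
rewrite (natr_prod_expB rn) (natr_prod_expB (leqnn n)) subnn exprMn => E.
have q0 m : (p ^ m)%N%:R != 0 :> R by rewrite pnatr_eq0 -lt0n expn_gt0 prime_gt0.
have NR0 : N%:R ^+ k.+1 != 0 :> R by rewrite expf_neq0 // pnatr_eq0 -lt0n.
have aR0 : a%:R != 0 :> R by rewrite pnatr_eq0.
have x0 := q0 (r * n)%N; have y0 := expf_neq0 k.+1 (q0 (n * n)%N).
have key (N' a' P' Q x y g' : R) : a' != 0 -> x != 0 -> y != 0 -> N' != 0 ->
    g' * a' * x * y = N' * (y * P') * (x * Q) -> g' * N'^-1 = a'^-1 * Q * P'.
  move=> a0' x0' y0' N0' E'; apply: (mulIf (mulf_neq0 (mulf_neq0 a0' x0') y0')).
  have -> : g' * N'^-1 * (a' * x * y) = (g' * a' * x * y) / N' by ring.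
  by rewrite E'; field; rewrite N0' a0'.
exact: key aR0 x0 y0 NR0 E.
Qed.

(** Indexed by [j < r], the product has a number of factors independent of [n], each tending to
    1. *)
Lemma cvg_prod_tail r :
  \prod_((n - r).+1 <= i < n.+1) (1 - p%:R ^- i) @[n --> \oo] --> (1 : R).
Proof.
have p1 : 1 < p%:R :> R by rewrite ltr1n prime_gt1.
have : \prod_(j < r) (1 - p%:R ^- (n - j)) @[n --> \oo] --> (1 : R).
  elim: r => [|r IH].
    by under eq_fun do rewrite big_ord0; apply: cvg_cst.
  under eq_fun do rewrite big_ord_recr /=.
  have pw0 : p%:R ^- (n - r) @[n --> \oo] --> (0 : R).
    have h : p%:R ^- n @[n --> \oo] --> (0 : R).
      under eq_fun do rewrite -exprVn.
      apply: cvg_expr; rewrite ger0_norm ?invr_ge0 ?ler0n //.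
      by rewrite invf_lt1 // (lt_trans ltr01).
    exact: cvg_comp (cvg_subnr r) h.
  have one : (1 : R) @[n --> \oo] --> (1 : R) by apply: cvg_cst.
  have := cvgM IH (cvgB one pw0).
  by rewrite subr0 mulr1; apply.
(* The two forms are matched only for [n >= r], where [n - r] is not truncated. *)
apply: cvg_trans; apply: near_eq_cvg; exists r => // n /= rn.
by rewrite prod_tail_ord.
Qed.

(** The partial products are nonincreasing and nonnegative. Convergence makes the [lim] in the
    theorem a genuine limit rather than a default value. *)
Lemma is_cvg_prod_1Bexp :
  cvg ((\prod_(1 <= i < n.+1) (1 - p%:R ^- i) : R) @[n --> \oo]).
Proof.
have p1 : 1 < p%:R :> R by rewrite ltr1n prime_gt1.
have p0 := lt_trans ltr01 p1.
have le1 i : p%:R ^- i <= 1 :> R by rewrite invf_le1 ?exprn_gt0 // exprn_ege1 // ltW.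
have ge0 n : 0 <= \prod_(1 <= i < n.+1) (1 - p%:R ^- i) :> R.
  by apply: prodr_ge0 => i _; rewrite subr_ge0.
apply: nonincreasing_is_cvgn; last by exists 0 => _ [n _ <-].
apply/nonincreasing_seqP => n; rewrite [X in X <= _]big_nat_recr //=.
by rewrite ler_piMr // gerBl invr_ge0 exprn_ge0 // ltW.
Qed.

End Formula.

Local Open Scope classical_set_scope.
Local Open Scope ring_scope.

Theorem theorem1p1 (R : realType) (p : nat) (p_pr : prime p) (k : nat)
    (G : flag p_pr k.+1) (finG : finite_set [set: G ord_max]) :
  (forall (n : nat), (prank (G ord_max) <= n)%N ->
   forall (d : measure_display) (T : measurableType d) (P : probability T R)
     (M : 'I_k.+1 -> {RV P >-> borel_mx p_pr n}),
   (forall i, haar_random (M i)) -> mutually_independent M ->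
   measurable (cok_event M G) /\
   P (cok_event M G) =
     ((ncard (flag_Aut G))%:R^-1
      * (\prod_((n - prank (G ord_max)).+1 <= i < n.+1) (1 - p%:R ^- i))
      * (\prod_(1 <= i < n.+1) (1 - p%:R ^- i)) ^+ k.+1)%:E)
  /\
  (forall (d : nat -> measure_display) (T : forall n, measurableType (d n))
     (P : forall n, probability (T n) R)
     (M : forall n, 'I_k.+1 -> {RV (P n) >-> borel_mx p_pr n}),
   (forall n i, haar_random (M n i)) ->
   (forall n, mutually_independent (M n)) ->
   P n (cok_event (M n) G) @[n --> \oo] -->
     ((ncard (flag_Aut G))%:R^-1
      * (lim ((\prod_(1 <= i < n.+1) (1 - p%:R ^- i) : R) @[n --> \oo]))
          ^+ k.+1)%:E).
Proof.
split=> [n rn d T P M M_haar M_indep|d T P M M_haar M_indep].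
  exact: probability_cok_formula.
set r := prank (G ord_max).
(* The formula is available only from [n = r] on, which suffices for the limit. *)
have E : \forall n \near \oo, P n (cok_event (M n) G) =
    ((ncard (flag_Aut G))%:R^-1
     * (\prod_((n - r).+1 <= i < n.+1) (1 - p%:R ^- i))
     * (\prod_(1 <= i < n.+1) (1 - p%:R ^- i)) ^+ k.+1)%:E.
  exists r => // n /= rn.
  by have [] := probability_cok_formula finG rn (M_haar n) (M_indep n).
apply: cvg_EFin.
  by apply: filterS E => n ->.
apply: (@cvg_trans _ ((ncard (flag_Aut G))%:R^-1
     * (\prod_((n - r).+1 <= i < n.+1) (1 - p%:R ^- i))
     * (\prod_(1 <= i < n.+1) (1 - p%:R ^- i)) ^+ k.+1 @[n --> \oo])).
  by apply: near_eq_cvg; apply: filterS E => n /= ->.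
apply: cvgM.
  have aut : ((ncard (flag_Aut G))%:R^-1 : R) @[n --> \oo] -->
    ((ncard (flag_Aut G))%:R^-1 : R) by apply: cvg_cst.
  by have := cvgM aut (cvg_prod_tail p_pr r); rewrite mulr1; apply.
apply: (continuous_cvg _ (@exprn_continuous R k.+1 _)).
exact: is_cvg_prod_1Bexp.
Qed.
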